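(* Let $k\ge3$ and let $\gamma_{2,k}:\Gamma_2\to\Gamma_k$ be the homomorphism $\gamma_{2,k}(f,g)=(\alpha_{2,k}(f),g)$. Then the $\Gamma_k$-conjugates of $\mathrm{im}\,\gamma_{2,k}$ are precisely the minimally full subgroups of $\Gamma_k$.
   Context: $\Omega$ is an infinite set with a fixed linear ordering $\le$; $[\Omega]^k$ is the set of $k$-subsets of $\Omega$. $\mathbb{Z}_4=\{0,1,2,3\}$ is the additive group of integers mod 4, and $\mathbb{F}_2$ is identified with its subgroup $\{0,2\}$. Define $\epsilon_2:\mathrm{Sym}(\Omega)\times[\Omega]^2\to\mathbb{Z}_4$ by: for $w=\{w_1,w_2\}$ with $w_1<w_2$, $\epsilon_2(g,w)=0$ if $gw_1<gw_2$ and $\epsilon_2(g,w)=1$ otherwise. For $k\ge3$ let $\epsilon_k(g,w)=\sum_{y\in[w]^2}\epsilon_2(g,y)\in\mathbb{Z}_4$ for $w\in[\Omega]^k$. For $k\ge2$ let $C_k=\mathbb{Z}_4\times[\Omega]^k$. Each pair $(f,g)\in\mathbb{F}_2^{[\Omega]^k}\times\mathrm{Sym}(\Omega)$ (with $f:[\Omega]^k\to\mathbb{F}_2$) is identified with the bijection of $C_k$ given by $(a,w)\mapsto(a+f(gw)+\epsilon_k(g,w),\,gw)$. $\Gamma_k$ is the set of all these bijections; it is a group under composition, regarded as a topological subgroup of $\mathrm{Sym}(C_k)$ (where $\mathrm{Sym}(C)$ has as open sets the unions of cosets of pointwise stabilizers of finite subsets of $C$). There is a surjection $\Gamma_k\to\mathrm{Sym}(\Omega)$,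 $(f,g)\mapsto g$, with kernel $\mathbb{F}_2^{[\Omega]^k}\times\{1\}$. A subgroup of $\Gamma_k$ is full if it is closed and maps onto $\mathrm{Sym}(\Omega)$; it is minimally full if it is full and has no proper full subgroup. $\alpha_{2,k}:\mathbb{F}_2^{[\Omega]^2}\to\mathbb{F}_2^{[\Omega]^k}$ is given by $\alpha_{2,k}(f)(w)=\sum_{y\in[w]^2}f(y)$, where $[w]^2$ is the set of 2-subsets of $w$. *)

(* Defs.v *)
From HB Require Import structures.
From mathcomp Require Import all_boot all_order all_algebra.
From mathcomp Require Import finmap ring.
From mathcomp Require Import boolp classical_sets cardinality topology_structure.

Set Implicit Arguments.
Unset Strict Implicit.
Unset Printing Implicit Defensive.

Import Order.TTheory GRing.Theory.

Local Open Scope classical_set_scope.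

(* Sym(X), acting on the left: (s * t) x = s (t x). *)
Record sym (X : Type) := Sym { sym_fun :> X -> X; sym_bij : bijective sym_fun }.

Section SymGroup.
Variable X : Type.
Implicit Types s t : sym X.

Lemma sym_ext s t : s =1 t -> s = t.
Proof.
case: s t => [s sb] [t tb] /= /funext st; case: _ / st tb => tb.
by congr Sym; apply: Prop_irrelevance.
Qed.

Lemma sym_inv_subproof s : {t : sym X | cancel s t & cancel t s}.
Proof.
apply: cid2; have [t st ts] := sym_bij s.
by exists (Sym (Bijective ts st)).
Qed.

Definition sym_one : sym X := Sym (inv_bij (frefl (@id X) : involutive id)).
Definition sym_mul s t : sym X := Sym (bij_comp (sym_bij s) (sym_bij t)).
Definition sym_inv s : sym X := s2val (sym_inv_subproof s).

Lemma sym_funK s : cancel s (sym_inv s).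
Proof. by rewrite /sym_inv; case: sym_inv_subproof. Qed.

Lemma sym_invK s : cancel (sym_inv s) s.
Proof. by rewrite /sym_inv; case: sym_inv_subproof. Qed.

Lemma sym_mulA : associative sym_mul.
Proof. by move=> s t u; apply: sym_ext. Qed.

Lemma sym_mul1 : left_id sym_one sym_mul.
Proof. by move=> s; apply: sym_ext. Qed.

Lemma sym_mulr1 : right_id sym_one sym_mul.
Proof. by move=> s; apply: sym_ext. Qed.

Lemma sym_mulV : left_inverse sym_one sym_inv sym_mul.
Proof. by move=> s; apply: sym_ext => x /=; rewrite sym_funK. Qed.

Lemma sym_mulVr : right_inverse sym_one sym_inv sym_mul.
Proof. by move=> s; apply: sym_ext => x /=; rewrite sym_invK. Qed.

HB.instance Definition _ := gen_eqMixin (sym X).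
HB.instance Definition _ := gen_choiceMixin (sym X).
HB.instance Definition _ := isGroup.Build (sym X)
  sym_mulA sym_mul1 sym_mulr1 sym_mulV sym_mulVr.

Lemma symM s t x : (s * t)%g x = s (t x). Proof. by []. Qed.
Lemma sym1 x : (1 : sym X)%g x = x. Proof. by []. Qed.
Lemma symK s : cancel s (s^-1)%g. Proof. exact: sym_funK. Qed.
Lemma symVK s : cancel (s^-1)%g s. Proof. exact: sym_invK. Qed.

Definition pointwise_stab (F : set X) : set (sym X) :=
  [set s | forall x, F x -> s x = x].

(* Left cosets suffice: a right coset of a pointwise stabilizer is a left coset
   of another one. *)
Definition stab_cosets : set (set (sym X)) :=
  [set U | exists s (F : set X),
     finite_set F /\ U = [set (s * t)%g | t in pointwise_stab F]].

Lemma stab_cosets_cover : \bigcup_(U in stab_cosets) U = setT.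
Proof.
apply/seteqP; split=> // s _; exists [set (s * t)%g | t in pointwise_stab set0].
  by exists s, set0.
by exists 1%g; rewrite ?mulg1.
Qed.

Lemma stab_cosets_join (U V : set (sym X)) s :
  stab_cosets U -> stab_cosets V -> U s -> V s ->
  exists W, [/\ stab_cosets W, W s & W `<=` U `&` V].
Proof.
move=> [u [F [Ffin ->]]] [v [G [Gfin ->]]] [u' u'F us] [v' v'G vs].
exists [set (s * t)%g | t in pointwise_stab (F `|` G)]; split.
- by exists s, (F `|` G); rewrite finite_setU.
- by exists 1%g; rewrite ?mulg1.
- move=> _ [t tFG <-]; split.
    exists (u' * t)%g; last by rewrite mulgA us.
    by move=> x Fx; rewrite symM tFG ?u'F//; left.
  exists (v' * t)%g; last by rewrite mulgA vs.
  by move=> x Gx; rewrite symM tFG ?v'G//; right.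
Qed.

HB.instance Definition _ := @isBaseTopological.Build (sym X)
  (set (sym X)) stab_cosets id stab_cosets_cover stab_cosets_join.

Lemma sym_openE : open =
  [set \bigcup_(U in D) U | D in [set D | D `<=` stab_cosets]] :> set (set (sym X)).
Proof. by []. Qed.

End SymGroup.

Section Subgroups.
Variable G : groupType.

Definition is_subgroup (H : set G) : Prop :=
  [/\ H 1%g, (forall x y, H x -> H y -> H (x * y)%g)
    & (forall x, H x -> H (x^-1)%g)].

Definition conjugate (c : G) (H : set G) : set G :=
  [set (c * h * c^-1)%g | h in H].

End Subgroups.

Section Gamma.
Context {d : Order.disp_t}.
Variable Omega : orderType d.

Definition ksub (k : nat) : Type := {w : {fset Omega} | #|` w|%fset == k}.
HB.instance Definition _ k := Choice.on (ksub k).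

Lemma ksub_act_subproof k (g : sym Omega) (w : ksub k) :
  #|` [fset g x | x in val w]|%fset == k.
Proof.
by rewrite card_imfset ?(eqP (valP w))//; exact: bij_inj (sym_bij g).
Qed.

Definition ksub_act k (g : sym Omega) (w : ksub k) : ksub k :=
  exist _ [fset g x | x in val w]%fset (ksub_act_subproof g w).

Definition pairs_of k (w : ksub k) : {fset ksub 2} :=
  [fset y in (pmap insub (fpowerset (val w)) : seq (ksub 2))]%fset.

Lemma in_pairs_of k (w : ksub k) (y : ksub 2) :
  (y \in pairs_of w) = (val y `<=` val w)%fset.
Proof. by rewrite !inE /= mem_pmap_sub fpowersetE. Qed.

Local Open Scope ring_scope.

Definition eps2 (g : sym Omega) (w : ksub 2) : 'Z_4 :=
  if sort <=%O (val w) is [:: w1; w2] then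
    if (g w1 < g w2)%O then 0 else 1
  else 0.

(* For k = 2 this is eps2 (lemma eps_eps2 below). *)
Definition eps k (g : sym Omega) (w : ksub k) : 'Z_4 :=
  \sum_(y <- pairs_of w) eps2 g y.

(* The isomorphism from F_2 onto the subgroup {0, 2} of Z_4. *)
Definition F2_Z4 (x : 'F_2) : 'Z_4 := (2 * x)%N%:R.

Definition C (k : nat) : Type := ('Z_4 * ksub k)%type.
Definition coords (k : nat) : Type := ((ksub k -> 'F_2) * sym Omega)%type.

Definition act_fun k (p : coords k) (z : C k) : C k :=
  (z.1 + F2_Z4 (p.1 (ksub_act p.2 z.2)) + eps p.2 z.2, ksub_act p.2 z.2).

Lemma ksub_actM k (g h : sym Omega) (w : ksub k) :
  ksub_act (g * h)%g w = ksub_act g (ksub_act h w).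
Proof. by apply/val_inj; rewrite /= -(imfset_comp _ h g). Qed.
Lemma ksub_act1 k (w : ksub k) : ksub_act 1%g w = w.
Proof. by apply/val_inj; rewrite /= imfset_id. Qed.

Lemma ksub_actK k g : cancel (@ksub_act k g) (ksub_act g^-1%g).
Proof. by move=> w; rewrite -ksub_actM mulVg ksub_act1. Qed.
Lemma ksub_actVK k g : cancel (@ksub_act k g^-1%g) (ksub_act g).
Proof. by move=> w; rewrite -ksub_actM mulgV ksub_act1. Qed.

Lemma act_fun_bij k (p : coords k) : bijective (act_fun p).
Proof.
exists (fun z => (z.1 - F2_Z4 (p.1 z.2) - eps p.2 (ksub_act p.2^-1%g z.2),
                  ksub_act p.2^-1%g z.2)) => -[a w]; rewrite /act_fun /=.
  by rewrite ksub_actK addrAC addrK addrK.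
by rewrite ksub_actVK addrAC subrK subrK.
Qed.

(* The bijection of C k identified with the pair p = (f, g). *)
Definition act k (p : coords k) : sym (C k) := Sym (act_fun_bij p).

Definition Gamma (k : nat) : set (sym (C k)) := range (@act k).
Arguments Gamma : clear implicits.

Definition closed_in_Gamma k (H : set (sym (C k))) : Prop :=
  exists2 K : set (sym (C k)), closed K & H = Gamma k `&` K.

Definition full k (H : set (sym (C k))) : Prop :=
  [/\ H `<=` Gamma k, is_subgroup H, closed_in_Gamma H
    & forall g : sym Omega, exists f : ksub k -> 'F_2, H (act (f, g))].

Definition minimally_full k (H : set (sym (C k))) : Prop :=
  full H /\ forall K, full K -> K `<=` H -> K = H.

Definition alpha2 k (f : ksub 2 -> 'F_2) (w : ksub k) : 'F_2 :=
  \sum_(y <- pairs_of w) f y.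

Definition gamma2 k (p : coords 2) : coords k := (@alpha2 k p.1, p.2).

Definition im_gamma2 k : set (sym (C k)) := range (fun p => act (gamma2 k p)).
Arguments im_gamma2 : clear implicits.

(* The identification of pairs with bijections is one-to-one, Gamma k is a
   group, and gamma2 induces a homomorphism Gamma 2 -> Gamma k. *)

Lemma ksub2P (w : ksub 2) : exists x y, (x < y)%O /\ val w = [fset x; y]%fset.
Proof.
have := fset_uniq (val w); have := valP w.
case E : (enum_fset (val w)) => [|x [|y []]] //= _; rewrite inE andbT.
have -> : val w = [fset x; y]%fset.
  apply/fsetP => z; have -> : (z \in val w) = (z \in enum_fset (val w)) by [].
  by rewrite E !inE.
case: (ltgtP x y) => // [xy|yx] _; first by exists x, y.
by exists y, x; rewrite fsetUC.
Qed.

Lemma eps2E g (w : ksub 2) x y : (x < y)%O -> val w = [fset x; y]%fset ->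
  eps2 g w = if (g x < g y)%O then 0 else 1.
Proof.
move=> xy wxy; rewrite /eps2 wxy.
suff -> : sort <=%O [fset x; y]%fset = [:: x; y] by [].
apply: (sorted_eq le_trans le_anti); first exact: (sort_sorted le_total).
  by rewrite /= ltW.
rewrite perm_sort uniq_perm ?fset_uniq//= ?inE ?lt_eqF//.
by move=> z; rewrite !inE.
Qed.

Lemma eps_eps2 g (w : ksub 2) : eps g w = eps2 g w.
Proof.
rewrite /eps; suff -> : pairs_of w = [fset w]%fset by rewrite big_seq_fset1.
apply/fsetP => y; rewrite in_pairs_of inE.
apply/idP/eqP => [yw|->//]; apply/val_inj/eqP.
by rewrite eqEfcard yw (eqP (valP w)) (eqP (valP y)).
Qed.

Lemma F2_Z4D : {morph F2_Z4 : x y / x + y}.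
Proof. by move=> [[|[|[]]]//= ?] [[|[|[]]]//= ?]; apply/val_inj. Qed.

Lemma F2_Z4_0 : F2_Z4 0 = 0. Proof. exact/val_inj. Qed.

Lemma F2_Z4_inj : injective F2_Z4.
Proof.
by move=> [[|[|[]]]//= ?] [[|[|[]]]//= ?] // /(congr1 val) //= _; apply/val_inj.
Qed.

Lemma sum_pairs_act (V : nmodType) k (g : sym Omega) (w : ksub k)
    (f : ksub 2 -> V) :
  \sum_(y <- pairs_of (ksub_act g w)) f y =
  \sum_(y <- pairs_of w) f (ksub_act g y).
Proof.
have inj2 := can_inj (@ksub_actK 2 g).
rewrite -(big_map (ksub_act g) xpredT f); apply: perm_big.
apply: uniq_perm; rewrite ?map_inj_uniq ?fset_uniq// => y.
rewrite in_pairs_of -[y](ksub_actVK g) mem_map// in_pairs_of.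
by apply/fsubsetP/fsubsetP => yw x; [
  move=> xy; have /imfsetP[z zw /(bij_inj (sym_bij g)) ->//] :=
    yw _ (in_imfset imfset_key g xy)
| move=> /imfsetP[z zy ->]; apply: in_imfset; exact: yw].
Qed.

Lemma eps2_cocycle g h (w : ksub 2) : exists c : 'F_2,
  eps2 g (ksub_act h w) + eps2 h w = eps2 (g * h)%g w + F2_Z4 c.
Proof.
have [x [y [xy wxy]]] := ksub2P w.
rewrite (eps2E h xy wxy) (eps2E (g * h)%g xy wxy) !symM.
have hw : val (ksub_act h w) = [fset h x; h y]%fset.
  apply/fsetP => z; rewrite !inE /= wxy.
  apply/imfsetP/orP => [[t /=]|]; first by
    rewrite !inE => /orP[] /eqP-> ->; rewrite eqxx; [left|right].
  by case=> /eqP->; [exists x|exists y]; rewrite //= !inE eqxx ?orbT.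
have [hxy|] := boolP (h x < h y)%O.
  by rewrite (eps2E g hxy hw); exists 0; rewrite F2_Z4_0 !addr0.
rewrite -leNgt le_eqVlt (inj_eq (bij_inj (sym_bij h))) gt_eqF//= => hyx.
rewrite fsetUC in hw; rewrite (eps2E g hyx hw).
case: (ltgtP (g (h x)) (g (h y))) => [||] gxy /=.
- by exists 1; apply/val_inj.
- by exists 0; apply/val_inj.
- by move/(bij_inj (sym_bij g))/(bij_inj (sym_bij h)): gxy => gxy;
    rewrite gxy ltxx in xy.
Qed.

Lemma eps_cocycle k g h (w : ksub k) : exists c : 'F_2,
  eps g (ksub_act h w) + eps h w = eps (g * h)%g w + F2_Z4 c.
Proof.
have [c cE] := choice (eps2_cocycle g h).
exists (\sum_(y <- pairs_of w) c y).
rewrite (big_morph _ F2_Z4D F2_Z4_0) /eps sum_pairs_act -!big_split /=.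
by apply: eq_bigr => y _; exact: cE.
Qed.

Lemma act_mul k (p q : coords k) : exists r : coords k, act r = (act p * act q)%g.
Proof.
have [c cE] := choice (@eps_cocycle k p.2 q.2).
pose v (w : ksub k) := ksub_act (p.2 * q.2)^-1%g w.
exists (fun w => p.1 w + q.1 (ksub_act q.2 (v w)) + c (v w), (p.2 * q.2)%g).
apply: sym_ext => -[a w]; congr (_, _) => /=; last exact: ksub_actM.
rewrite /v ksub_actK ksub_actM !F2_Z4D.
transitivity (a + F2_Z4 (p.1 (ksub_act p.2 (ksub_act q.2 w))) +
  F2_Z4 (q.1 (ksub_act q.2 w)) + (eps (p.2 * q.2)%g w + F2_Z4 (c w))).
  by ring.
by rewrite -cE; ring.
Qed.

Lemma F2_Z4_double x : F2_Z4 x + F2_Z4 x = 0.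
Proof. by rewrite -F2_Z4D -F2_Z4_0; congr F2_Z4; case: x => [[|[|[]]]//= ?]; apply/val_inj. Qed.

Lemma eps1 k (w : ksub k) : exists c : 'F_2, eps 1%g w = F2_Z4 c.
Proof.
have [c] := eps_cocycle 1%g 1%g w; rewrite ksub_act1 mulg1 => /addrI cE.
by exists c.
Qed.

Lemma Gamma_subgroup k : is_subgroup (Gamma k).
Proof.
split.
- have [c cE] := choice (@eps1 k).
  exists (c, 1%g) => //; apply: sym_ext => -[a w]; congr (_, _) => /=.
    by rewrite ksub_act1 cE -addrA F2_Z4_double addr0.
  exact: ksub_act1.
- move=> _ _ [p _ <-] [q _ <-]; have [r <-] := act_mul p q; by exists r.
- move=> _ [p _ <-]; have [c cE] := choice (@eps_cocycle k p.2^-1%g p.2).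
  have [e eE] := choice (@eps1 k).
  exists (fun w => p.1 (ksub_act p.2 w) + (e w + c w), p.2^-1%g) => //.
  suff rp : (act (fun w => p.1 (ksub_act p.2 w) + (e w + c w), p.2^-1%g) *
    act p = 1)%g by rewrite -[LHS]mulg1 -(mulgV (act p)) mulgA rp mul1g.
  apply: sym_ext => -[a w]; congr (_, _) => /=; last by rewrite ksub_actK.
  rewrite ksub_actK !F2_Z4D.
  transitivity (a + (F2_Z4 (p.1 (ksub_act p.2 w)) + F2_Z4 (p.1 (ksub_act p.2 w)))
    + F2_Z4 (e w) + F2_Z4 (c w) + (eps p.2^-1%g (ksub_act p.2 w) + eps p.2 w)).
    by ring.
  rewrite cE mulVg eE F2_Z4_double addr0.
  transitivity (a + (F2_Z4 (e w) + F2_Z4 (e w)) + (F2_Z4 (c w) + F2_Z4 (c w))).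
    by ring.
  by rewrite !F2_Z4_double !addr0.
Qed.

Lemma ksub_avoid k (x y : Omega) : infinite_set [set: Omega] -> (0 < k)%N ->
  x != y -> exists w : ksub k, x \in val w /\ y \notin val w.
Proof.
move=> Oinf k0 xy.
have : infinite_set ([set: Omega] `\` [set x; y]) by exact: infinite_setD.
move=> /(infinite_set_fset k) [B Bxy kB].
pose A : {fset Omega} := [fset z in x :: take k.-1 (enum_fset B)]%fset.
have Bx z : z \in take k.-1 (enum_fset B) -> z != x /\ z != y.
  move=> /mem_take zB; have /= [_ /not_orP [/eqP zx /eqP zy]] := Bxy z zB.
  by [].
have cA : #|` A|%fset == k.
  have kB' : (k.-1 <= size (enum_fset B))%N by exact: leq_trans (leq_pred k) kB.
  rewrite card_fseq undup_id /= ?size_takel// ?prednK//.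
  by rewrite take_uniq// andbT; apply/negP => /Bx[]; rewrite eqxx.
exists (exist _ A cA); split; first by rewrite /= !inE eqxx.
rewrite /= !inE eq_sym (negbTE xy) /=.
by apply/negP => /Bx[_]; rewrite eqxx.
Qed.

Lemma ksub_act_inj k (g h : sym Omega) : infinite_set [set: Omega] ->
  (0 < k)%N -> (forall w : ksub k, ksub_act g w = ksub_act h w) -> g = h.
Proof.
move=> Oinf k0 gh; apply: sym_ext => x; apply/eqP/negPn/negP => gxhx.
have /(ksub_avoid Oinf k0)[w [xw yw]] : x != (g^-1)%g (h x).
  by apply: contra_neq gxhx => {1}->; rewrite symVK.
have /imfsetP[z /= zw hxgz] : h x \in val (ksub_act g w).
  by rewrite gh; apply: in_imfset.
by move: yw; rewrite hxgz symK zw.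
Qed.

Lemma act_inj k : infinite_set [set: Omega] -> (0 < k)%N -> injective (@act k).
Proof.
move=> Oinf k0 [f g] [f' g'] pq.
have pqE a w : act_fun (f, g) (a, w) = act_fun (f', g') (a, w).
  exact: (congr1 (fun s : sym (C k) => s (a, w)) pq).
have gg' : g = g'.
  by apply: (@ksub_act_inj k) => // w; exact: (congr1 (@snd _ _) (pqE 0 w)).
rewrite -{}gg' in pqE *; congr (_, _); apply/funext => w.
have := congr1 (@fst _ _) (pqE 0 (ksub_act g^-1%g w)).
by rewrite /= ksub_actVK => /addIr/addrI/F2_Z4_inj.
Qed.

Lemma gamma2_morph k (p q r : coords 2) : infinite_set [set: Omega] ->
  act r = (act p * act q)%g ->
  act (gamma2 k r) = (act (gamma2 k p) * act (gamma2 k q))%g.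
Proof.
move=> Oinf rpq.
have E a y : act_fun r (a, y) = act_fun p (act_fun q (a, y)).
  exact: (congr1 (fun s : sym (C 2) => s (a, y)) rpq).
have r2 : r.2 = (p.2 * q.2)%g.
  by apply: (@ksub_act_inj 2) => // y; rewrite ksub_actM; exact: (congr1 (@snd _ _) (E 0 y)).
have E1 y : F2_Z4 (r.1 (ksub_act r.2 y)) + eps2 r.2 y =
    F2_Z4 (q.1 (ksub_act q.2 y)) + eps2 q.2 y +
    (F2_Z4 (p.1 (ksub_act p.2 (ksub_act q.2 y))) + eps2 p.2 (ksub_act q.2 y)).
  by have := congr1 (@fst _ _) (E 0 y); rewrite /= !add0r !eps_eps2 -!addrA.
apply: sym_ext => -[a w]; congr (_, _) => /=; last by rewrite r2 ksub_actM.
rewrite -!addrA; congr (a + _); rewrite /alpha2.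
rewrite !(big_morph _ F2_Z4D F2_Z4_0) !sum_pairs_act /eps sum_pairs_act.
by rewrite -!big_split /=; apply: eq_bigr => y _; rewrite E1 -!addrA.
Qed.

End Gamma.

Arguments Gamma {d} Omega k _.
Arguments im_gamma2 {d} Omega k _.

(* Main.v *)
Require Import Defs.
From HB Require Import structures.
From mathcomp Require Import all_boot all_order all_algebra.
From mathcomp Require Import finmap ring.
From mathcomp Require Import boolp classical_sets cardinality filter.
From mathcomp Require Import topology_structure.

Set Implicit Arguments.
Unset Strict Implicit.
Unset Printing Implicit Defensive.

Import Order.TTheory GRing.Theory.

Local Open Scope classical_set_scope.

(** Write K for the kernel F_2^([Omega]^k) of Gamma k -> Sym(Omega) and I for
    the image of gamma_{2,k}, so that the kernel of I is the image A of
    alpha_{2,k}.  Everything follows from two facts about I: it is full, and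
    every full subgroup contains a conjugate of it (full_contains_conjugate).
    For if a full subgroup lies in c I c^-1, it contains some b I b^-1, and an
    inclusion between two conjugates of I is an equality, because modulo I
    the conjugating element may be taken in K, which is abelian
    (conjugate_sub_eq).  Only the closedness of I is not formal: preimages
    of approximations converge along an ultrafilter (im_gamma2_full).

    Let H be full.  If Omega is the set of rationals, its group of
    order-preserving permutations is extremely amenable; acting on the compact
    space K / (H meet K) through the elements (0,g), it fixes a point, that
    is, some conjugate of H contains all (0,g) with g order preserving.  As
    a general Omega may be rigid, full_normalise says this for
    order-preserving maps between finite subsets.  The fixed point is the
    limit of arbitrary lifts to H along an ultrafilter under which the image of
    each increasing sequence is generic for iterated quantifiers over a free
    ultrafilter U on Omega.

    Let H be so normalised.  Lifts of a transposition (a b) are compared with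
    (0,(a b)) on a finite set consisting of a, b and a U-generic sequence r
    lying on one side of both.  By indiscernibility such a lift is
    (f,(a b)) with f(w) determined by the two truth values of a in w and b in
    w.  Three observations put A and f in H.  If b (or a) is removed,
    then (a b) is order preserving on the rest, so the restriction of f lies
    in the kernel of H.  The kernel is normalised by H, hence invariant under
    Sym(Omega), so the points a and b in these functions are arbitrary; then
    constant terms can be split off by summing over a (kernel_point_const).
    Finally, squaring the lift turns the pair inverted by (a b) into the
    indicator of the k-sets containing both a and b, because 1 + 1 = 2 in
    Z_4; these indicators generate A (pair_indicator_mem, alpha2_mem).
    Hence (0,(a b)) is locally in H when a and b are the two first points
    of the finite set (standard_initial_swap).

    Other transpositions are reached by rotating a finite sequence, moving its
    last point z in front.  Lifts of this map need not be trivial: by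
    indiscernibility they are so only up to a multiple of the indicator of z
    in w.  But that function is invariant under permutations fixing z, so the
    error cancels when a transposition is conjugated by the rotation
    (standard_swap_rotate).  Transpositions generate, A is in H, and so
    I is contained in H. *)

(** * Transpositions of a set *)

Section Transposition.
Variable X : eqType.
Implicit Types (g : sym X) (s t : seq X).

Definition swap (a b x : X) : X :=
  if x == a then b else if x == b then a else x.

Lemma swapK a b : involutive (swap a b).
Proof.
move=> x; rewrite /swap; have [->|xa] := eqVneq x a.
  by case: eqVneq => [->|]; rewrite ?eqxx.
have [->|xb] := eqVneq x b; first by rewrite eqxx.
by rewrite (negbTE xa) (negbTE xb).
Qed.

Definition tsym a b : sym X := Sym (inv_bij (swapK a b)).

Lemma tsymE a b x : tsym a b x = swap a b x. Proof. by []. Qed.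

Lemma tsymL a b : tsym a b a = b.
Proof. by rewrite tsymE /swap eqxx. Qed.

Lemma tsymR a b : tsym a b b = a.
Proof. by rewrite tsymE /swap eqxx; case: eqVneq. Qed.

Lemma tsymD a b x : x != a -> x != b -> tsym a b x = x.
Proof. by rewrite tsymE /swap => /negbTE-> /negbTE->. Qed.

Lemma tsymC a b : tsym a b = tsym b a.
Proof.
apply: sym_ext => x; rewrite !tsymE /swap.
by case: eqVneq => [->|]; case: eqVneq.
Qed.

Lemma tsymM a b : (tsym a b * tsym a b)%g = 1%g.
Proof. by apply: sym_ext => x; rewrite symM [LHS]swapK. Qed.

Lemma tsymV a b : (tsym a b)^-1%g = tsym a b.
Proof. by apply: (mulgI (tsym a b)); rewrite mulgV tsymM. Qed.

Lemma sym_inj g : injective g. Proof. exact: bij_inj (sym_bij g). Qed.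

Lemma tsymJ g a b : tsym a b = (g^-1 * tsym (g a) (g b) * g)%g.
Proof.
apply: sym_ext => x; rewrite !symM !tsymE /swap !(inj_eq (@sym_inj g)).
case: eqVneq => [_|_]; first by rewrite symK.
by case: eqVneq => [_|_]; rewrite symK.
Qed.

(** A permutation that is right on the tail is corrected at the head by a
    transposition of two points outside the tail and its image. *)
Lemma sym_extend s t : uniq s -> uniq t -> size s = size t ->
  exists g, map g s = t.
Proof.
elim: s t => [[]// _ _ _|x s IHs [//|y t] /= /andP[xs us] /andP[yt ut] [st]].
  by exists 1%g.
have [g gst] := IHs t us ut st; exists (tsym (g x) y * g)%g.
congr (_ :: _); first by rewrite symM tsymL.
rewrite -[RHS]gst; apply/eq_in_map => z zs; rewrite symM tsymD//.
  by rewrite (inj_eq (@sym_inj g)); apply: contraNneq xs => <-.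
by apply: contraNneq yt => <-; rewrite -gst map_f.
Qed.

End Transposition.

(** * Iterated ultrafilter quantifiers *)

Section Almost.
Variables (X : choiceType) (U : set_system X).
Hypothesis UF : UltraFilter U.

(** For U-almost all x1, for U-almost all x2, and so on up to xn.  These
    iterated quantifiers take the place of Ramsey's theorem: a generic
    sequence is indiscernible (almost_subseq), and since U is an ultrafilter
    each property or its negation holds generically (almost_ultra). *)
Fixpoint almost (n : nat) (P : seq X -> Prop) : Prop :=
  if n is n'.+1 then U [set x | almost n' (fun l => P (x :: l))] else P [::].

Lemma almostW n (P Q : seq X -> Prop) :
  (forall l, size l = n -> P l -> Q l) -> almost n P -> almost n Q.
Proof.
elim: n P Q => [|n IHn] P Q PQ /=; first exact: PQ.
by apply: filterS => x; apply: IHn => l ln; apply: PQ; rewrite /= ln.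
Qed.

Lemma almost_all n (P : seq X -> Prop) :
  (forall l, size l = n -> P l) -> almost n P.
Proof.
elim: n P => [|n IHn] P allP /=; first exact: allP.
by apply: filterE => x; apply: IHn => l ln; apply: allP; rewrite /= ln.
Qed.

Lemma almostI n (P Q : seq X -> Prop) :
  almost n P -> almost n Q -> almost n (fun l => P l /\ Q l).
Proof.
elim: n P Q => [|n IHn] P Q //= aP aQ.
by apply: filterS (filterI aP aQ) => x [Px Qx]; exact: IHn.
Qed.

Lemma almost_ultra n (P : seq X -> Prop) :
  almost n P \/ almost n (fun l => ~ P l).
Proof.
elim: n P => [|n IHn] P /=; first exact: EM.
have [|nP] := in_ultra_setVsetC [set x | almost n (fun l => P (x :: l))] UF.
  by left.
by right; apply: filterS nP => x /= nPx; case: (IHn (fun l => P (x :: l))).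
Qed.

Lemma almost_ex n (P : seq X -> Prop) : almost n P ->
  exists l, size l = n /\ P l.
Proof.
elim: n P => [|n IHn] P /=; first by exists [::].
by move=> /filter_ex[x /IHn[l [ln Pl]]]; exists (x :: l); rewrite /= ln.
Qed.

(** Quantifiers over the coordinates that m drops are vacuous. *)
Lemma almost_mask m (P : seq X -> Prop) : almost (count id m) P ->
  almost (size m) (fun l => P (mask m l)).
Proof.
elim: m P => [|[] m IHm] P //=.
  by apply: filterS => x; exact: IHm.
by rewrite add0n => aP; apply: filterE => x; exact: IHm.
Qed.

(** A subsequence starts with the head x of the sequence or avoids it; in the
    first case the rest is generic for the property at x, and in the second the
    tail is generic for P itself. *)
Lemma almost_subseq n m (P : seq X -> Prop) : almost m P ->
  almost n (fun l => forall u, subseq u l -> size u = m -> P u).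
Proof.
elim: n m P => [|n IHn] m P aP /=.
  by case=> [_|//]; case: m aP.
case: m aP => [|m] /= aP.
  by apply: filterE => x; apply: almost_all => l _ [].
have aP' := IHn m.+1 P aP; apply: filterS aP => x /(IHn m) aPx.
apply: almostW (almostI aPx aP') => l _ [Px Pl] [//|y u] /=.
by case: eqVneq => [-> /Px Pu [/Pu]|_ /Pl Pu].
Qed.

End Almost.

(** * Generic sequences in a linear order *)

Section Direction.
Context {d : Order.disp_t}.
Variable Omega : orderType d.
Implicit Types (x y : Omega) (s : seq Omega) (g : sym Omega) (e : bool).

(** A generic sequence is monotone, but in a direction that depends on Omega:
    in the natural numbers it increases, in the negative integers it
    decreases.  All later arguments are insensitive to the direction. *)
Definition prec e x y := if e then (x < y)%O else (y < x)%O.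

Lemma prec_irr e : irreflexive (prec e).
Proof. by move=> x; case: e => /=; rewrite ltxx. Qed.

Lemma prec_trans e : transitive (prec e).
Proof.
by case: e => y x z /= xy yz; [exact: lt_trans yz|exact: lt_trans xy].
Qed.

Lemma prec_uniq e s : sorted (prec e) s -> uniq s.
Proof. exact: sorted_uniq (@prec_trans e) (@prec_irr e) _. Qed.

Lemma prec_enum e (S : {fset Omega}) :
  exists s, [/\ sorted (prec e) s, s =i S & size s = #|` S|].
Proof.
have sS : sorted <%O (sort <=%O S) by rewrite sort_lt_sorted fset_uniq.
exists (if e then sort <=%O S else rev (sort <=%O S)); split.
- by case: e => //; rewrite rev_sorted.
- by move=> x; case: e; rewrite ?mem_rev mem_sort.
- by case: e; rewrite ?size_rev size_sort.
Qed.

Definition increasing_on (S : {fset Omega}) g :=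
  {in S &, {homo g : x y / (x < y)%O}}.

Lemma increasing_onP e s g (S : {fset Omega}) : s =i S ->
  sorted (prec e) s -> sorted (prec e) (map g s) <-> increasing_on S g.
Proof.
move=> sS ss; split=> [gs x y|gS].
  rewrite -!sS => xs ys xy.
  have [i ni xE] : exists2 i, (i < size s)%N & x = nth x s i.
    by exists (index x s); rewrite ?index_mem ?nth_index.
  have [j nj yE] : exists2 j, (j < size s)%N & y = nth x s j.
    by exists (index y s); rewrite ?index_mem ?nth_index.
  have H := sorted_ltn_nth (@prec_trans e) x ss.
  have H' := sorted_ltn_nth (@prec_trans e) (g x) gs.
  have [ij|ji|ij] := ltngtP i j; last by move: xy; rewrite xE yE ij ltxx.
    have := H i j ni nj ij; rewrite -xE -yE => pxy.
    have := H' i j; rewrite !inE !size_map => /(_ ni nj ij).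
    rewrite !(nth_map x)// -xE -yE; case: e {ss gs H H'} pxy => //= yx.
    by have := lt_trans xy yx; rewrite ltxx.
  have := H j i nj ni ji; rewrite -xE -yE => pyx.
  have := H' j i; rewrite !inE !size_map => /(_ nj ni ji).
  rewrite !(nth_map x)// -xE -yE; case: e {ss gs H H'} pyx => //= yx.
  by have := lt_trans xy yx; rewrite ltxx.
rewrite (sorted_pairwise (@prec_trans e)) in ss.
rewrite (sorted_pairwise (@prec_trans e)) pairwise_map.
apply: (sub_in_pairwise (P := mem s)) ss => [x y /=|]; last exact/allP.
by rewrite !sS => xS yS; case: (e) => /=; exact: gS.
Qed.

Lemma increasing_onS (S T : {fset Omega}) g : (S `<=` T)%fset ->
  increasing_on T g -> increasing_on S g.
Proof. by move=> /fsubsetP ST gT x y /ST xT /ST yT; exact: gT. Qed.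

Section Ultra.
Variable U : set_system Omega.
Hypothesis UF : UltraFilter U.
Hypothesis U_free : forall x, U [set y | y != x].

(** For each x the ultrafilter decides between the points above and below x,
    and then it decides which of the two cases is the almost sure one. *)
Lemma ultra_direction : exists e, U [set x | U [set y | prec e x y]].
Proof.
have [|nU] := in_ultra_setVsetC [set x | U [set y | (x < y)%O]] UF.
  by exists true.
exists false; apply: filterS nU => x /= nUx.
have [//|nUx'] := in_ultra_setVsetC [set y | (x < y)%O] UF.
apply: filterS (filterI nUx' (U_free x)) => y [/= /negP].
by rewrite -leNgt le_eqVlt => /orP[->|].
Qed.

Lemma almost_sorted e n : U [set x | U [set y | prec e x y]] ->
  almost U n (fun l => sorted (prec e) l).
Proof.
move=> Ue; have all_prec x m : U [set y | prec e x y] ->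
    almost U m (fun l => all (prec e x) l).
  move=> Ux; elim: m => //= m IHm.
  by apply: filterS Ux => y xy; apply: almostW IHm => l _ /= ->; rewrite xy.
elim: n => //= n IHn; apply: filterS Ue => x /(all_prec x n) Px.
apply: almostW (almostI UF Px IHn) => l _ [al sl].
by rewrite (path_sortedE (@prec_trans e)) al.
Qed.

End Ultra.

End Direction.

Lemma free_ultrafilter (X : choiceType) : infinite_set [set: X] ->
  exists2 U : set_system X, UltraFilter U & forall x, U [set y | y != x].
Proof.
move=> Xinf.
pose F : set_system X := [set A | finite_set (~` A)].
have FF : ProperFilter F.
  apply: Build_ProperFilter; first by rewrite /F /= setC0.
  split.
  - by rewrite /F /= setCT.
  - by move=> A B FA FB; rewrite /F /= setCI finite_setU.
  - by move=> A B AB; apply: sub_finite_set; exact: subsetC.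
have [U [UF FU]] := ultraFilterLemma FF.
exists U => // x; apply: FU; rewrite /F /=.
by apply: (@sub_finite_set _ _ [set x]) => // y /= /negP/negPn/eqP.
Qed.

Lemma F2P (x : 'F_2) : x = 0%R \/ x = 1%R.
Proof. by case: x => [[|[|[]]]//= ?]; [left|right]; apply/val_inj. Qed.

Lemma F2_addxx (x : 'F_2) : (x + x = 0)%R.
Proof. by case: (F2P x) => ->; apply/val_inj. Qed.

(** The compactness of F_2^T, as convergence along an ultrafilter. *)
Lemma ultra_lim (X T : Type) (V : set_system X) (f : X -> T -> 'F_2) :
  UltraFilter V -> exists c : T -> 'F_2, forall t, V [set p | f p t = c t].
Proof.
move=> VF; suff /choice[c cP] : forall t, exists c, V [set p | f p t = c].
  by exists c.
move=> t.
have [|nV] := in_ultra_setVsetC [set p | f p t = 1%R] VF; first by exists 1%R.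
by exists 0%R; apply: filterS nV => p /= np; case: (F2P (f p t)) => // /np.
Qed.

(** Indiscernibility for a colouring f.  The relation E u w says how the
    coloured object w is read off the sequence u, and it determines w, so
    that the colour 1 or else the colour 0 occurs generically. *)
Lemma almost_value (X : choiceType) (U : set_system X) (T : Type) m
    (E : seq X -> T -> Prop) (f : seq X -> T -> 'F_2) :
  UltraFilter U -> (forall u w w', E u w -> E u w' -> w = w') ->
  exists c, forall n, almost U n (fun l =>
    forall u, subseq u l -> size u = m -> forall w, E u w -> f u w = c).
Proof.
move=> UF Euniq.
have [a|a] := almost_ultra UF m (fun u => forall w, E u w -> f u w = 1%R).
  by exists 1%R => n; exact: almost_subseq.
exists 0%R => n; apply: almost_subseq; apply: (almostW UF) a.
move=> u _ /existsNP[w /not_implyP[Ew fw]] w' Ew'.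
by rewrite (Euniq _ _ _ Ew' Ew); case: (F2P (f u w)).
Qed.

(** * The function epsilon and finite restrictions *)

Section Eps.
Context {d : Order.disp_t}.
Variable Omega : orderType d.
Implicit Types (x y a b : Omega) (g h : sym Omega) (S T : {fset Omega}).

Local Open Scope ring_scope.

Definition img g S : {fset Omega} := [fset g x | x in S]%fset.

Lemma in_img g S x : (x \in img g S) = ((g^-1)%g x \in S).
Proof. by rewrite -{1}[x](symVK g) /img mem_imfset//; exact: sym_inj. Qed.

Lemma mem_img g S x : (g x \in img g S) = (x \in S).
Proof. by rewrite in_img symK. Qed.

Lemma imgM g h S : img (g * h)%g S = img g (img h S).
Proof. by apply/fsetP => x; rewrite !in_img invgM. Qed.

Lemma img1 S : img 1%g S = S.
Proof. by apply/fsetP => x; rewrite in_img invg1. Qed.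

Lemma imgS g S T : (S `<=` T)%fset -> (img g S `<=` img g T)%fset.
Proof. by move/fsubsetP => ST; apply/fsubsetP => x; rewrite !in_img => /ST. Qed.

Lemma img_eq g h S : {in S, g =1 h} -> img g S = img h S.
Proof.
by move=> gh; apply/fsetP => x; apply/imfsetP/imfsetP => -[y /= yS ->];
  exists y => //=; rewrite gh.
Qed.

Lemma val_act k g (w : ksub Omega k) : val (ksub_act g w) = img g (val w).
Proof. by []. Qed.

Lemma act_eq k g h (w : ksub Omega k) S : (val w `<=` S)%fset ->
  {in S, g =1 h} -> ksub_act g w = ksub_act h w.
Proof.
by move=> /fsubsetP wS gh; apply/val_inj/img_eq => x /wS; exact: gh.
Qed.

Lemma in_act k g (w : ksub Omega k) x :
  (x \in val (ksub_act g w)) = ((g^-1)%g x \in val w).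
Proof. by rewrite val_act in_img. Qed.

Lemma pair_exists a b : a != b ->
  exists y : ksub Omega 2, val y = [fset a; b]%fset.
Proof.
move=> ab; have c2 : #|` [fset a; b]%fset|%fset == 2 by rewrite cardfs2 ab.
by exists (exist (fun w : {fset Omega} => #|` w|%fset == 2) _ c2).
Qed.

Lemma eps2_eq g h (y : ksub Omega 2) : {in val y, g =1 h} ->
  eps2 g y = eps2 h y.
Proof.
have [x [z [xz yE]]] := ksub2P y; rewrite yE => gh.
by rewrite !(eps2E _ xz yE) !gh ?inE ?eqxx ?orbT.
Qed.

Lemma eps_eq k g h (w : ksub Omega k) : {in val w, g =1 h} ->
  eps g w = eps h w.
Proof.
move=> gh; rewrite /eps !big_seq; apply: eq_bigr => y.
rewrite in_pairs_of => /fsubsetP yw.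
by apply: eps2_eq => x /yw; exact: gh.
Qed.

Lemma eps_increasing k g (w : ksub Omega k) : increasing_on (val w) g ->
  eps g w = 0.
Proof.
move=> gw; rewrite /eps big_seq big1// => y.
rewrite in_pairs_of => /fsubsetP; have [x [z [xz yE]]] := ksub2P y.
rewrite yE => yw.
by rewrite (eps2E _ xz yE) gw// yw// !inE eqxx ?orbT.
Qed.

Lemma eps_one k (w : ksub Omega k) : eps 1%g w = 0.
Proof. by apply: eps_increasing => x y. Qed.

(** The defect of additivity of epsilon is a sum over pairs, hence in the image
    of alpha.  So the elements (0,g) form a group modulo that image. *)
Lemma eps_cocycle_alpha g h : exists c : ksub Omega 2 -> 'F_2,
  forall k (w : ksub Omega k),
  eps g (ksub_act h w) + eps h w = eps (g * h)%g w + F2_Z4 (alpha2 c w).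
Proof.
have [c cE] := choice (eps2_cocycle g h).
exists c => k w; rewrite /alpha2 (big_morph _ F2_Z4D F2_Z4_0) /eps.
by rewrite sum_pairs_act -!big_split /=; apply: eq_bigr => y _; exact: cE.
Qed.

Lemma alpha2_delta k (y0 : ksub Omega 2) (w : ksub Omega k) :
  alpha2 (fun y : ksub Omega 2 => (y == y0)%:R) w =
    (val y0 `<=` val w)%fset%:R :> 'F_2.
Proof.
rewrite /alpha2 -in_pairs_of; have [yw|yw] := boolP (y0 \in _).
  rewrite (big_fsetD1 y0)//= eqxx big1_seq ?addr0// => y /andP[_].
  by rewrite in_fsetD1 => /andP[/negbTE->].
rewrite big1_seq// => y /andP[_ yin]; case: eqVneq => // yE.
by rewrite -yE yin in yw.
Qed.

Definition adjacent_in S a b :=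
  {in S, forall x, x != a -> x != b -> (x < a)%O = (x < b)%O}.

(** The only pair inverted by the transposition of adjacent points a and b is
    the pair of a and b itself, and it contributes 1 twice.  This is where Z_4,
    as opposed to F_2 + F_2, makes the cover non-trivial. *)
Lemma eps_swap_square k a b (w : ksub Omega k) : a != b ->
  adjacent_in (val w) a b ->
  eps (tsym a b) (ksub_act (tsym a b) w) + eps (tsym a b) w =
  F2_Z4 ((a \in val w) && (b \in val w))%:R.
Proof.
move=> ab abw; have [y0 y0E] := pair_exists ab.
transitivity (F2_Z4 (alpha2 (fun y : ksub Omega 2 => (y == y0)%:R) w)); last first.
  by rewrite alpha2_delta y0E fsubUset !fsub1set.
rewrite /alpha2 (big_morph _ F2_Z4D F2_Z4_0) /eps sum_pairs_act -big_split /=.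
rewrite !big_seq; apply: eq_bigr => y; rewrite in_pairs_of => /fsubsetP.
have [x [z [xz yE]]] := ksub2P y; rewrite yE => yw.
have xw : x \in val w by apply: yw; rewrite !inE eqxx.
have zw : z \in val w by apply: yw; rewrite !inE eqxx orbT.
have tyE : val (ksub_act (tsym a b) y) = [fset tsym a b x; tsym a b z]%fset.
  apply/fsetP => u; rewrite in_act yE !inE.
  by rewrite -[in RHS](symVK (tsym a b) u) !(inj_eq (@sym_inj _ _)).
have yy0 : (y == y0) = ((x == a) && (z == b)) || ((x == b) && (z == a)).
  rewrite -(inj_eq val_inj) yE y0E; apply/eqP/idP => [xab|]; last first.
    by case/orP => /andP[/eqP-> /eqP->] //; rewrite fsetUC.
  have : x \in [fset a; b]%fset by rewrite -xab !inE eqxx.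
  have : z \in [fset a; b]%fset by rewrite -xab !inE eqxx orbT.
  have xNz : x != z by rewrite lt_eqF.
  rewrite !inE => /orP[] /eqP zE /orP[] /eqP xE; rewrite zE xE ?eqxx ?orbT//;
    by rewrite xE zE eqxx in xNz.
rewrite yy0 (eps2E _ xz yE).
have ltt u v : u \in val w -> v \in val w -> (u < v)%O ->
    ~~ (((u == a) && (v == b)) || ((u == b) && (v == a))) ->
    (tsym a b u < tsym a b v)%O.
  move=> uw vw uv; rewrite negb_or !negb_and => /andP[H1 H2].
  rewrite !tsymE /swap; have abwu := abw u uw; have abwv := abw v vw.
  have gtE (p q : Omega) : p != q -> (p < q)%O = ~~ (q < p)%O.
    by move=> pq; rewrite -leNgt le_eqVlt (negbTE pq).
  have [ua|ua] := eqVneq u a.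
    rewrite ua eqxx /= in H1 uv; have [va|va] := eqVneq v a.
      by rewrite va ltxx in uv.
    rewrite (negbTE H1); rewrite gtE 1?eq_sym// -abwv// -gtE// eq_sym//.
  have [ub|ub] := eqVneq u b.
    rewrite ub eqxx /= in H2 uv; rewrite (negbTE H2).
    have [vb|vb] := eqVneq v b; first by rewrite vb ltxx in uv.
    by rewrite gtE 1?eq_sym// abwv// -gtE// eq_sym.
  have [va|va] := eqVneq v a; first by rewrite -abwu// -va.
  by have [vb|vb] := eqVneq v b; first by rewrite abwu// -vb.
have [ty|nty] := boolP (_ || _); last first.
  have := ltt _ _ xw zw xz nty => txz.
  have tyE' := eps2E (tsym a b) txz tyE.
  rewrite tyE' -!symM tsymM !sym1 xz txz F2_Z4_0 addr0//.
have txz : (tsym a b z < tsym a b x)%O.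
  by case/orP: ty => /andP[/eqP xE /eqP zE]; subst; rewrite tsymL tsymR.
rewrite fsetUC in tyE; rewrite (eps2E _ txz tyE) -!symM tsymM !sym1.
by rewrite ltNge (ltW xz)/= ltNge (ltW txz) /=; apply/val_inj.
Qed.

End Eps.

(** * Transpositions and the order *)

Section Swaps.
Context {d : Order.disp_t}.
Variable Omega : orderType d.
Variable e : bool.
Implicit Types (a b : Omega) (S : {fset Omega}) (r s : seq Omega).
Implicit Types g : sym Omega.

Lemma img_fset g s : img g [fset x in s]%fset = [fset x in map g s]%fset.
Proof.
apply/fsetP => x; rewrite in_img !inE -[in RHS](symVK g x).
by rewrite (mem_map (@sym_inj _ g)).
Qed.

Lemma swap_fix a b r : uniq [:: a, b & r] -> map (tsym a b) r = r.
Proof.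
rewrite /= inE negb_or => /and3P[/andP[_ ar] br _].
rewrite -[RHS]map_id; apply/eq_in_map => x xr; apply: tsymD.
  by apply: contraNneq ar => <-.
by apply: contraNneq br => <-.
Qed.

(** The only pair that the transposition of a and b inverts is destroyed by
    removing b. *)
Lemma swap_increasing_l a b r : sorted (prec e) [:: a, b & r] ->
  increasing_on [fset x in a :: r]%fset (tsym a b).
Proof.
move=> ls; have sE : a :: r =i [fset x in a :: r]%fset by move=> x; rewrite !inE.
have ss : subseq (a :: r) [:: a, b & r].
  by rewrite /= eqxx; exact: subseq_cons.
have ar := subseq_sorted (@prec_trans _ Omega e) ss ls.
apply/(increasing_onP _ sE ar).
rewrite map_cons (swap_fix (prec_uniq ls)) tsymL.
exact: path_sorted ls.
Qed.

Lemma swap_increasing_r a b r : sorted (prec e) [:: a, b & r] ->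
  increasing_on [fset x in b :: r]%fset (tsym a b).
Proof.
move=> ls; have sE : b :: r =i [fset x in b :: r]%fset by move=> x; rewrite !inE.
have br := path_sorted ls.
apply/(increasing_onP _ sE br).
rewrite map_cons (swap_fix (prec_uniq ls)) tsymR.
have ss : subseq (a :: r) [:: a, b & r].
  by rewrite /= eqxx; exact: subseq_cons.
exact: (subseq_sorted (@prec_trans _ Omega e) ss ls).
Qed.

Lemma swap_adjacent a b r S : sorted (prec e) [:: a, b & r] ->
  (S `<=` [fset x in [:: a, b & r]])%fset -> adjacent_in S a b.
Proof.
move=> ls Sr x /(fsubsetP Sr); rewrite !inE => + /negbTE xa /negbTE xb.
rewrite xa xb /= => xr.
have := ls; rewrite (sorted_pairwise (@prec_trans _ Omega e)) /=.
move=> /and3P[/andP[_ /allP/(_ x xr) ax] /allP/(_ x xr) bx _].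
case: (e) ax bx => /= ax bx.
  by rewrite ltNge (ltW ax) ltNge (ltW bx).
by rewrite ax bx.
Qed.

Lemma img_swap a b S : a \in S -> b \in S -> img (tsym a b) S = S.
Proof.
move=> aS bS; apply/fsetP => x; rewrite in_img tsymV tsymE /swap.
by case: eqVneq => [->|_]; [rewrite aS bS|case: eqVneq => [->|//]; rewrite aS bS].
Qed.

Lemma in_swap_l k a b (w : ksub Omega k) :
  (a \in val (ksub_act (tsym a b) w)) = (b \in val w).
Proof. by rewrite -{1}(tsymR a b) val_act mem_img. Qed.

Lemma in_swap_r k a b (w : ksub Omega k) :
  (b \in val (ksub_act (tsym a b) w)) = (a \in val w).
Proof. by rewrite -{1}(tsymL a b) val_act mem_img. Qed.

End Swaps.

(** * Closed subgroups of Gamma *)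

Lemma sym_nbhsP (X : Type) (p : sym X) (B : set (sym X)) :
  nbhs p B <-> exists F, finite_set F /\
    forall s : sym X, (forall x, F x -> s x = p x) -> B s.
Proof.
rewrite nbhsE /=; split.
  move=> [O [Oo Op] OB]; move: Oo; rewrite sym_openE /= => -[D Dc OE].
  move: Op; rewrite -OE => -[V DV Vp].
  have [s [F [Ff VE]]] := Dc V DV; exists F; split=> // s' s'p; apply: OB.
  rewrite -OE; exists V => //; move: Vp; rewrite VE => -[t tF st].
  exists (t * (p^-1 * s'))%g; last by rewrite mulgA st mulgA mulgV mul1g.
  by move=> x Fx; rewrite !symM s'p// symK tF.
move=> [F [Ff FB]].
exists [set (p * t)%g | t in pointwise_stab F]; last first.
  by move=> _ [t tF <-]; apply: FB => x Fx; rewrite symM tF.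
split; last by exists 1%g; rewrite ?mulg1.
rewrite sym_openE /=.
exists [set [set (p * t)%g | t in pointwise_stab F]]; last by rewrite bigcup_set1.
by move=> _ ->; exists p, F.
Qed.

Section GammaBasics.
Context {d : Order.disp_t}.
Variable Omega : orderType d.
Hypothesis Omega_infinite : infinite_set [set: Omega].
Variable k : nat.
Hypothesis k_gt0 : (0 < k)%N.
Implicit Types (H : set (sym (C Omega k))) (p q : coords Omega k).

Local Open Scope ring_scope.

(** The form in which closedness is used: membership in H is tested on finite
    subsets of C. *)
Definition locally_closed H := forall p,
  (forall F, finite_set F -> exists2 s, H s & forall z, F z -> s z = act p z) ->
  H (act p).

Lemma closed_locally H : H `<=` Gamma Omega k ->
  closed_in_Gamma H <-> locally_closed H.
Proof.
move=> HG; split=> [[K Kc ->] p pH|Hc].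
  split; first by exists p.
  apply: Kc => B /sym_nbhsP[F [Ff FB]].
  have [s [_ Ks] sF] := pH F Ff; exists s; split=> //; exact: FB.
exists (closure H); first exact: closed_closure.
apply/seteqP; split=> [s Hs|_ [[p _ <-] pH]].
  by split; [exact: HG|exact: subset_closure].
apply: Hc => F Ff.
have [|s [Hs sF]] := pH [set s | forall z, F z -> s z = act p z]; last by exists s.
by apply/sym_nbhsP; exists F.
Qed.

Definition full_local H := [/\ H `<=` Gamma Omega k, is_subgroup H,
  locally_closed H & forall g, exists f : ksub Omega k -> 'F_2, H (act (f, g))].

Lemma full_localP H : full H <-> full_local H.
Proof.
split=> -[HG Hs Hc Hf]; split=> //; first by apply/closed_locally.
by apply/closed_locally.
Qed.

Lemma GammaM s t : Gamma Omega k s -> Gamma Omega k t -> Gamma Omega k (s * t)%g.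
Proof. by have [_ + _] := Gamma_subgroup Omega k; apply. Qed.

Lemma GammaV s : Gamma Omega k s -> Gamma Omega k (s^-1)%g.
Proof. by have [_ _] := Gamma_subgroup Omega k; apply. Qed.

(** The amount by which p translates the fibre Z_4 over w.  In contrast with
    the coordinates f of p, shifts simply add up under composition. *)
Definition shift p (w : ksub Omega k) : 'Z_4 :=
  F2_Z4 (p.1 (ksub_act p.2 w)) + eps p.2 w.

Lemma actE p a w : act p (a, w) = (a + shift p w, ksub_act p.2 w).
Proof. by rewrite /= /act_fun /= /shift addrA. Qed.

Lemma act_prod p q : exists r, [/\ act r = (act p * act q)%g,
  r.2 = (p.2 * q.2)%g &
  forall w, shift r w = shift q w + shift p (ksub_act q.2 w)].
Proof.
have [r rE] := act_mul p q; exists r.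
have E w : act r (0, w) =
    (shift q w + shift p (ksub_act q.2 w), ksub_act (p.2 * q.2)%g w).
  by rewrite rE symM !actE add0r ksub_actM.
split=> //; last by move=> w; have := congr1 fst (E w); rewrite actE add0r.
apply: (ksub_act_inj Omega_infinite k_gt0) => w.
by have := congr1 snd (E w); rewrite actE.
Qed.

Lemma act_inv p : exists r, [/\ act r = (act p)^-1%g,
  r.2 = (p.2^-1)%g & forall w, shift r (ksub_act p.2 w) = - shift p w].
Proof.
have [r _ rE] : Gamma Omega k (act p)^-1%g by apply: GammaV; exists p.
exists r; have E w : act r (shift p w, ksub_act p.2 w) = (0, w).
  by rewrite rE -[shift p w]add0r -actE symK.
split=> //.
  apply: (ksub_act_inj Omega_infinite k_gt0) => w.
  by have := congr1 snd (E (ksub_act p.2^-1%g w)); rewrite actE ksub_actVK.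
move=> w; have /eqP := congr1 fst (E w).
by rewrite actE /= addrC addr_eq0 => /eqP.
Qed.

Lemma conjugate_full c H : Gamma Omega k c -> full H -> full (conjugate c H).
Proof.
move=> Gc /full_localP[HG [H1 HM HV] Hc Hf]; apply/full_localP; split.
- by move=> _ [h Hh <-]; apply: GammaM (GammaV Gc); apply: GammaM => //; exact: HG.
- split.
  + by exists 1%g; rewrite ?mulg1 ?mulgV.
  + move=> _ _ [x Hx <-] [y Hy <-]; exists (x * y)%g; first exact: HM.
    by rewrite !mulgA mulgVK.
  + move=> _ [x Hx <-]; exists (x^-1)%g; first exact: HV.
    by rewrite !invgM invgK mulgA.
- move=> p pH; exists (c^-1 * act p * c)%g; last first.
    by rewrite !mulgA mulgV mul1g mulgK.
  have [q _ qE] : Gamma Omega k (c^-1 * act p * c)%g.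
    by apply: GammaM => //; apply: GammaM; [exact: GammaV|exists p].
  rewrite -qE; apply: Hc => F Ff.
  have [_ [h Hh <-] hF] := pH [set c z | z in F] (finite_image _ Ff).
  exists h => // z Fz; rewrite qE !symM -hF; last by exists z.
  by rewrite !symM !symK.
- move=> g; have [pc _ pcE] := Gc.
  have [f Hfg] := Hf (pc.2^-1 * g * pc.2)%g.
  have [q [qE q2 _]] := act_prod pc (f, (pc.2^-1 * g * pc.2)%g).
  have [pv [pvE pv2 _]] := act_inv pc.
  have [r [rE r2 _]] := act_prod q pv.
  exists r.1; have <- : r.2 = g.
    by rewrite r2 q2 pv2 /= !mulgA mulgV mul1g mulgK.
  rewrite -surjective_pairing rE qE pvE -pcE.
  by exists (act (f, (pc.2^-1 * g * pc.2)%g)).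
Qed.

End GammaBasics.

(** * The image of gamma is full *)

Lemma filter_all_seq (X : Type) (T : eqType) (V : set_system X) (s : seq T)
    (P : T -> X -> Prop) : Filter V -> (forall t, t \in s -> V [set p | P t p]) ->
  V [set p | forall t, t \in s -> P t p].
Proof.
move=> VF; elim: s => [|t s IHs] Vs; first by apply: filterE.
have Vt : V [set p | P t p] by apply: Vs; rewrite mem_head.
have {}IHs : V [set p | forall t, t \in s -> P t p].
  by apply: IHs => u us; apply: Vs; rewrite inE us orbT.
apply: filterS (filterI Vt IHs) => p [/= tp sp] u.
by rewrite inE => /predU1P[->|/sp].
Qed.

Section ImageFull.
Context {d : Order.disp_t}.
Variable Omega : orderType d.
Hypothesis Omega_infinite : infinite_set [set: Omega].
Variable k : nat.
Hypothesis k_gt0 : (0 < k)%N.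
Implicit Types (p : coords Omega k) (q : coords Omega 2).

Local Open Scope ring_scope.

Lemma act_kernel1 j (c : ksub Omega j -> 'F_2) :
  c =1 (fun=> 0) -> act (c, 1%g) = 1%g.
Proof.
move=> c0; apply: sym_ext => -[a w].
by rewrite actE /shift /= c0 F2_Z4_0 eps_one !addr0 ksub_act1.
Qed.

Lemma alpha2_0 (c : ksub Omega 2 -> 'F_2) (w : ksub Omega k) :
  c =1 (fun=> 0) -> alpha2 c w = 0.
Proof. by move=> c0; rewrite /alpha2 big1. Qed.

Lemma im_gamma2_subgroup : is_subgroup (im_gamma2 Omega k).
Proof.
have act1 : act (gamma2 k (fun=> 0, 1%g) : coords Omega k) = 1%g.
  by apply: act_kernel1 => w; rewrite alpha2_0.
split; first by exists (fun=> 0, 1%g).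
- move=> _ _ [p _ <-] [q _ <-].
  have [r [rE _ _]] := act_prod Omega_infinite (isT : (0 < 2)%N) p q.
  by exists r => //; exact: gamma2_morph.
- move=> _ [p _ <-].
  have [r [rE _ _]] := act_inv Omega_infinite (isT : (0 < 2)%N) p.
  exists r => //; apply: (mulIg (act (gamma2 k p))); rewrite mulVg -act1.
  apply/esym/gamma2_morph => //; rewrite rE mulVg.
  exact: act_kernel1.
Qed.

(** The image of x is read off the images of finitely many k-subsets: one
    containing x, and for each other point y of it one containing x but
    not y. *)
Lemma eventually_pointwise V (h : coords Omega 2 -> sym Omega) (g : sym Omega) x :
    Filter V ->
    (forall w : ksub Omega k, V [set q | ksub_act (h q) w = ksub_act g w]) ->
  V [set q | h q x = g x].
Proof.
move=> VF Vact.
have [y0 yx0] : exists y, x != y.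
  apply/not_existsP => /= H; apply: Omega_infinite.
  apply: (@sub_finite_set _ _ [set x]) => // y _ /=; apply/eqP.
  by have := H y; move/negP/negPn; rewrite eq_sym.
have [u [xu _]] := ksub_avoid Omega_infinite k_gt0 yx0.
have := @filter_all_seq _ _ V (val u : {fset Omega})
  (fun y q => y != x -> exists w : ksub Omega k,
    [/\ x \in val w, y \notin val w & ksub_act (h q) w = ksub_act g w]) VF.
move=> Vu; have {Vu} : V [set q | forall y, y \in (val u : {fset Omega}) ->
    y != x -> exists w : ksub Omega k,
    [/\ x \in val w, y \notin val w & ksub_act (h q) w = ksub_act g w]].
  apply: Vu => y yu; have [->|yx] := eqVneq y x; first by apply: filterE.
  rewrite eq_sym in yx; have [w [xw yw]] := ksub_avoid Omega_infinite k_gt0 yx.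
  by apply: filterS (Vact w) => q qw _; exists w.
move=> Vu; apply: filterS (filterI (Vact u) Vu) => q [/= qu qy].
have : h q x \in val (ksub_act g u) by rewrite -qu val_act mem_img.
rewrite in_act => /qy.
have [E _|_ /(_ isT)[w [xw yw qw]]] := eqVneq ((g^-1)%g (h q x)) x.
  by rewrite /= -[in RHS]E symVK.
by move: yw; rewrite -in_act -qw val_act mem_img xw.
Qed.

(** Only closedness needs an argument.  If p is approximated by images of
    gamma, the first coordinates of their preimages converge along an
    ultrafilter to some f, and alpha f = p.1 because alpha f(w) involves
    finitely many values of f. *)
Lemma im_gamma2_full : full (im_gamma2 Omega k).
Proof.
apply/full_localP; split.
- by move=> _ [q _ <-]; exists (gamma2 k q).
- exact: im_gamma2_subgroup.
- move=> p pI.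
  pose F : set_system (coords Omega 2) := [set D | exists2 E, finite_set E &
    [set q | forall z, E z -> act (gamma2 k q) z = act p z] `<=` D].
  have FF : ProperFilter F.
    apply: Build_ProperFilter.
      by move=> [E /pI[_ [q _ <-] qE] /(_ q)]; exact.
    split; first by exists set0.
    - move=> A B [E1 E1f E1A] [E2 E2f E2B]; exists (E1 `|` E2).
        by rewrite finite_setU.
      move=> q qE; split; first by apply: E1A => z Ez; apply: qE; left.
      by apply: E2B => z Ez; apply: qE; right.
    - by move=> A B AB [E Ef EA]; exists E => //; exact: subset_trans EA AB.
  have [V [VF FV]] := ultraFilterLemma FF.
  have Vact z : V [set q | act (gamma2 k q) z = act p z].
    by apply: FV; exists [set z] => // q /= /(_ z erefl).
  have [f fE] := ultra_lim (fun q : coords Omega 2 => q.1) VF.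
  have Vpt x : V [set q : coords Omega 2 | q.2 x = p.2 x].
    apply: eventually_pointwise => w; apply: filterS (Vact (0, w)) => q.
    by rewrite /= => /(congr1 snd).
  exists (f, p.2) => //; congr act; rewrite [RHS]surjective_pairing /gamma2 /=.
  congr (_, _); apply/funext => w.
  pose w0 := ksub_act p.2^-1%g w.
  have V1 := filter_all_seq (s := pairs_of w) _ (fun y _ => fE y).
  have V2 := filter_all_seq (s := val w0 : {fset Omega}) _ (fun y _ => Vpt y).
  have [q [[/= q1 q2] q3]] :=
    filter_ex (filterI (filterI (V1 _) (V2 _)) (Vact (0, w0))).
  have qw : ksub_act q.2 w0 = w.
    by rewrite (act_eq (S := val w0) (h := p.2))// ksub_actVK.
  move: q3 => /= /(congr1 fst) /=; rewrite !add0r qw ksub_actVK (eps_eq (h := p.2))//.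
  move=> /addIr/F2_Z4_inj <-; rewrite /alpha2 !big_seq.
  by apply: eq_bigr => y yw; rewrite q1.
- by move=> g; exists (gamma2 k (fun=> 0, g)).1, (fun=> 0, g).
Qed.

End ImageFull.

(** * Order-preserving elements in a conjugate of a full subgroup *)

Section Normalisation.
Context {d : Order.disp_t}.
Variable Omega : orderType d.
Hypothesis Omega_infinite : infinite_set [set: Omega].
Variable k : nat.
Hypothesis k_gt0 : (0 < k)%N.
Implicit Types (H : set (sym (C Omega k))) (p : coords Omega k).
Implicit Types (S T : {fset Omega}) (g h : sym Omega) (s : seq Omega).

Local Open Scope ring_scope.

(** A partial element of H: since H is closed, it is determined by such finite
    data.  The shift theta is recorded, and not the coordinates f, because
    shifts compose additively. *)
Definition lifts H S g (theta : ksub Omega k -> 'Z_4) :=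
  exists p, [/\ H (act p), {in S, p.2 =1 g} &
    forall w, (val w `<=` S)%fset -> shift p w = theta w].

(** As epsilon vanishes on order-preserving maps, this says that H contains
    (0,g) locally, for each g that preserves the order on a finite set. *)
Definition lifts_increasing H :=
  forall S g, increasing_on S g -> lifts H S g (fun=> 0).

Lemma eps_increasing_comp g h (w : ksub Omega k) :
  increasing_on (val w) h -> eps g (ksub_act h w) = eps (g * h)%g w.
Proof.
move=> hw; rewrite /eps sum_pairs_act !big_seq; apply: eq_bigr => y.
rewrite in_pairs_of => /fsubsetP; have [x [z [xz yE]]] := ksub2P y.
rewrite yE => yw; have hxz : (h x < h z)%O.
  by rewrite hw// yw// !inE eqxx ?orbT.
rewrite (eps2E _ xz yE) (eps2E g hxz)// val_act yE.
apply/fsetP => u; rewrite in_img !inE.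
by rewrite -[u in RHS](symVK h) !(inj_eq (@sym_inj _ _)).
Qed.

Definition ksubs S : seq (ksub Omega k) := pmap insub (fpowerset S).

Lemma in_ksubs S (w : ksub Omega k) : (w \in ksubs S) = (val w `<=` S)%fset.
Proof. by rewrite /ksubs mem_pmap_sub fpowersetE. Qed.

Lemma sorted_lt_mask s1 s : sorted <%O s1 -> sorted <%O s ->
  {subset s1 <= s} -> mask (map (mem s1) s) s = s1.
Proof.
move=> s1s ss s1Ss; rewrite -filter_mask; apply: lt_sorted_eq => //.
  by apply: sorted_filter => //; exact: lt_trans.
by move=> x; rewrite mem_filter /=; case: (boolP (x \in s1)) => //= /s1Ss.
Qed.

(** The sets in the conclusion have the finite intersection property: two
    increasing sequences lie in a third one, on which both properties are
    generic by almost_mask; a generic sequence is injective, so some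
    permutation maps s to it, and this lifts to H. *)
Lemma generic_ultrafilter (U : set_system Omega) H : UltraFilter U ->
    (forall x, U [set y | y != x]) -> full H ->
  exists2 V : set_system (coords Omega k), UltraFilter V &
  forall s P, sorted <%O s -> almost U (size s) P ->
    V [set p : coords Omega k | H (act p) /\ P (map p.2 s)].
Proof.
move=> UF U_free [_ _ _ Hf].
pose F : set_system (coords Omega k) := [set D | exists s P,
  [/\ sorted <%O s, almost U (size s) P &
   forall p, H (act p) -> P (map p.2 s) -> D p]].
have FF : ProperFilter F.
  apply: Build_ProperFilter.
    move=> [s [P [ss aP PD]]]; have [e Ue] := ultra_direction UF U_free.
    have [l [ls [Pl lu]]] :=
      almost_ex UF (almostI UF aP (almost_sorted UF (size s) Ue)).
    have [g gl] : exists g : sym Omega, map g s = l.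
      by apply: sym_extend => //; [exact: lt_sorted_uniq|exact: prec_uniq lu].
    by have [f Hfg] := Hf g; apply: (PD (f, g)) => //=; rewrite gl.
  split.
  - by exists [::], (fun=> True).
  - move=> A B [s1 [P1 [s1s aP1 PA]]] [s2 [P2 [s2s aP2 PB]]].
    have [s [ss sE _]] := prec_enum true [fset x in s1 ++ s2]%fset.
    have s1E : mask (map (mem s1) s) s = s1.
      by apply: sorted_lt_mask => // x xs; rewrite sE in_fset_cat !inE xs.
    have s2E : mask (map (mem s2) s) s = s2.
      by apply: sorted_lt_mask => // x xs; rewrite sE in_fset_cat !inE xs orbT.
    have aM t P : mask (map (mem t) s) s = t -> almost U (size t) P ->
        almost U (size s) (fun l => P (mask (map (mem t) s) l)).
      move=> tE aP; rewrite -[in size s](size_map (mem t)); apply: almost_mask => //.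
      by rewrite -[in size t]tE size_mask ?size_map in aP.
    exists s, (fun l => P1 (mask (map (mem s1) s) l) /\
                        P2 (mask (map (mem s2) s) l)); split=> //.
      by apply: almostI => //; exact: aM.
    by move=> p Hp; rewrite -!map_mask s1E s2E => -[/PA ? /PB ?]; split; auto.
  - by move=> A B AB [s [P [? ? PA]]]; exists s, P; split=> // p Hp /(PA p Hp)/AB.
have [V [VF FV]] := ultraFilterLemma FF.
by exists V => // s P ss aP; apply: FV; exists s, P; split.
Qed.

(** Let kappa be the limit, along the ultrafilter of generic_ultrafilter, of
    the first coordinate of p in H, pulled back by p.  If h preserves the order on
    S, then S and h S, listed in increasing order, can be sent by elements p
    and q of H to the same generic sequence, with first coordinates pulled back
    to kappa.  Then q^-1 p acts on S as h does, and conjugation by (kappa,1)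
    turns its shift into 0. *)
Lemma full_normalise H : full H ->
  exists2 c, Gamma Omega k c & lifts_increasing (conjugate c H).
Proof.
move=> Hfull; have [_ [H1 HM HV] _ _] := Hfull.
have [U UF U_free] := free_ultrafilter Omega_infinite.
have [V VF Vgen] := generic_ultrafilter UF U_free Hfull.
have [kappa kE] :=
  ultra_lim (fun (p : coords Omega k) w => p.1 (ksub_act p.2 w)) VF.
pose c : coords Omega k := (kappa, 1%g).
exists (act c); first by exists c.
pose good s l := exists p, [/\ H (act p), map p.2 s = l &
  forall w, (val w `<=` [fset x in s])%fset -> p.1 (ksub_act p.2 w) = kappa w].
(* Otherwise almost every p would send s to a sequence that is not good,
   though p itself witnesses that it is. *)
have almost_good s : sorted <%O s -> almost U (size s) (good s).
  move=> ss; have [//|/(Vgen _ _ ss) Vbad] := almost_ultra UF (size s) (good s).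
  have := filter_all_seq (s := ksubs [fset x in s]%fset) _ (fun w _ => kE w).
  move=> Vk; have [p [/= pk [Hp []]]] := filter_ex (filterI (Vk _) Vbad).
  by exists p; split=> // w wS; apply: pk; rewrite in_ksubs.
move=> S h hS; have [s [ss sE _]] := prec_enum true S.
have hs : sorted <%O (map h s) by exact/(increasing_onP _ (e := true) sE).
have := almost_good _ hs; rewrite size_map => ahs.
have [l [_ [[p [Hp pl pk]] [q [Hq ql qk]]]]] :=
  almost_ex UF (almostI UF (almost_good s ss) ahs).
have pq : {in S, p.2 =1 (q.2 * h)%g}.
  have /eq_in_map E : map p.2 s = map (q.2 * h)%g s by rewrite pl -ql -map_comp.
  by move=> x xS; apply: E; rewrite sE.
have [qv [qvE qv2 qvs]] := act_inv Omega_infinite k_gt0 q.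
have [r [rE r2 rs]] := act_prod Omega_infinite k_gt0 qv p.
have [r' [r'E r'2 r's]] := act_prod Omega_infinite k_gt0 c r.
have [cv [cvE cv2 cvs]] := act_inv Omega_infinite k_gt0 c.
have [t [tE t2 ts]] := act_prod Omega_infinite k_gt0 r' cv.
have cS w : shift c w = F2_Z4 (kappa w).
  by rewrite /shift /= ksub_act1 eps_one addr0.
have cvS w : shift cv w = - F2_Z4 (kappa w).
  by have := cvs w; rewrite ksub_act1 cS.
have t2E : t.2 = r.2 by rewrite t2 r'2 cv2 /= mul1g invg1 mulg1.
have rh : {in S, r.2 =1 h}.
  by move=> x xS; rewrite r2 qv2 symM pq// symM symK.
exists t; split.
- rewrite tE r'E cvE rE qvE; exists ((act q)^-1 * act p)%g => //.
  exact: HM (HV _ Hq) Hp.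
- by move=> x xS; rewrite t2E rh.
- move=> w wS; rewrite ts cv2 /= invg1 ksub_act1 r's cvS cS rs.
  have hw : ksub_act r.2 w = ksub_act h w by exact: act_eq wS rh.
  have pw : ksub_act p.2 w = ksub_act q.2 (ksub_act h w).
    by rewrite -ksub_actM; exact: act_eq wS pq.
  rewrite hw pw qvs /shift.
  have -> : eps p.2 w = eps q.2 (ksub_act h w).
    rewrite eps_increasing_comp; last exact: increasing_onS wS hS.
    by apply: eps_eq => x /(fsubsetP wS); exact: pq.
  rewrite pk; last first.
    by apply: fsubset_trans wS _; apply/fsubsetP => x; rewrite !inE sE.
  rewrite qk; last first.
    by apply/fsubsetP => x; rewrite val_act in_img !inE => /(fsubsetP wS);
      rewrite -sE -{2}[x](symVK h); exact: map_f.
  by ring.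
Qed.

End Normalisation.

(** * Colourings that depend on two points of a generic sequence *)

Lemma almost_forall (X : choiceType) (U : set_system X) (I : finType) n
    (P : I -> seq X -> Prop) : UltraFilter U ->
  (forall i, almost U n (P i)) -> almost U n (fun l => forall i, P i l).
Proof.
move=> UF aP; suff : almost U n (fun l => forall i, i \in enum I -> P i l).
  by apply: almostW => l _ Pl i; apply: Pl; rewrite mem_enum.
elim: (enum I) => [|i s IHs]; first exact: almost_all.
apply: almostW (almostI UF (aP i) IHs) => l _ [Pi Ps] j.
by rewrite inE => /predU1P[->|/Ps].
Qed.

Section Generic.
Context {d : Order.disp_t}.
Variable Omega : orderType d.
Variable k : nat.
Variable U : set_system Omega.
Hypothesis UF : UltraFilter U.
Variable e : bool.
Hypothesis Ue : U [set x | U [set y | prec e x y]].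
Variable Phi : Omega -> Omega -> ksub Omega k -> 'F_2.

(** Given which of a and b belong to w, the set w is listed by a subsequence of
    r of fixed size, so almost_value applies to each of the four cases. *)
Lemma generic_initial_pair : exists c : bool -> bool -> 'F_2, forall n,
  exists a b r, [/\ size r = n, sorted (prec e) [:: a, b & r] &
    forall w, (val w `<=` [fset x in [:: a, b & r]])%fset ->
      Phi a b w = c (a \in val w) (b \in val w)].
Proof.
pose E (ij : bool * bool) u (w : ksub Omega k) := exists a b v,
  u = [:: a, b & v] /\
  val w =i nseq ij.1 a ++ nseq ij.2 b ++ v.
pose f u w := if u is [:: a, b & _] then Phi a b w else 0%R.
have Euniq ij u w w' : E ij u w -> E ij u w' -> w = w'.
  move=> [a [b [v [-> wE]]]] [_ [_ [_ [[<- <- <-] w'E]]]].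
  by apply/val_inj/fsetP => x; rewrite wE w'E.
have /choice[c cP] (ij : bool * bool) :=
  @almost_value _ U _ (k - (ij.1 + ij.2)).+2 (E ij) f UF (@Euniq ij).
exists (fun i j => c (i, j)) => n.
have [l [ln [lP ls]]] := almost_ex UF (almostI UF
  (almost_forall UF (fun ij => cP ij n.+2)) (almost_sorted UF n.+2 Ue)).
case: l ln ls lP => [|a [|b r]]// [rn] ls lP.
exists a, b, r; split=> // w /fsubsetP wl.
pose v := [seq x <- r | x \in val w].
have /= /and3P[] := prec_uniq ls; rewrite inE negb_or => /andP[ab ar] br ur.
have wE : val w =i nseq (a \in val w) a ++ nseq (b \in val w) b ++ v.
  move=> x; rewrite !mem_cat !mem_nseq mem_filter /= !lt0b.
  have [xw|xw] := boolP (x \in val w).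
    move: (wl x xw); rewrite !inE => /or3P[/eqP xE|/eqP xE|->].
    - by rewrite -xE xw eqxx.
    - by rewrite -xE xw eqxx orbT.
    - by rewrite !orbT.
  by rewrite andFb orbF; apply/esym/negbTE; rewrite negb_or; apply/andP; split;
    apply: contra xw => /andP[? /eqP->].
have wu : uniq (nseq (a \in val w) a ++ nseq (b \in val w) b ++ v).
  have vN x : x \notin r -> x \notin v.
    by apply: contra; rewrite mem_filter => /andP[].
  have uv : uniq v by exact: filter_uniq.
  by case: (a \in val w); case: (b \in val w);
    rewrite /= ?inE ?negb_or ?ab ?vN ?uv.
have := perm_size (uniq_perm (fset_uniq (val w)) wu wE).
rewrite !size_cat !size_nseq (eqP (valP w)) => kE.
have vr : subseq v r by exact: filter_subseq.
have := lP (a \in val w, b \in val w) [:: a, b & v].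
case: (a \in val w) (b \in val w) kE wE => [] [] /= kE wE;
  rewrite !eqxx; apply=> //; rewrite ?kE; try (by exists a, b, v).
all: by rewrite addnA addKn.
Qed.

Lemma generic_end_pair : exists c : bool -> 'F_2, forall n,
  exists a r z, [/\ size r = n, sorted (prec e) (a :: rcons r z) &
    forall w, (val w `<=` [fset x in rcons r z])%fset ->
      Phi a z w = c (z \in val w)].
Proof.
pose E (j : bool) u (w : ksub Omega k) := exists a v z,
  u = a :: rcons v z /\ val w =i nseq j z ++ v.
pose f u w := if u is a :: u' then Phi a (last a u') w else 0%R.
have Euniq j u w w' : E j u w -> E j u w' -> w = w'.
  move=> [a [v [z [-> wE]]]] [_ [v' [z' [[_ /rcons_inj[<- <-]] w'E]]]].
  by apply/val_inj/fsetP => x; rewrite wE w'E.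
have /choice[c cP] (j : bool) :=
  @almost_value _ U _ (k - j).+2 (E j) f UF (@Euniq j).
exists c => n.
have [l [ln [lP ls]]] := almost_ex UF (almostI UF
  (almost_forall UF (fun j => cP j n.+2)) (almost_sorted UF n.+2 Ue)).
case: l ln ls lP => [//|a l]; case/lastP: l => [//|r z].
rewrite /= size_rcons => -[rn] ls lP.
exists a, r, z; split=> // w /fsubsetP wl.
pose v := [seq x <- r | x \in val w].
have := @prec_uniq _ _ e (a :: rcons r z) ls.
rewrite cons_uniq rcons_uniq => /and3P[_ zr ur].
have wE : val w =i nseq (z \in val w) z ++ v.
  move=> x; rewrite mem_cat mem_nseq mem_filter /= !lt0b.
  have [xw|xw] := boolP (x \in val w).
    move: (wl x xw); rewrite !inE mem_rcons inE => /orP[/eqP xE|->].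
      by rewrite -xE xw eqxx.
    by rewrite !orbT.
  by rewrite andFb orbF; apply/esym/negbTE; apply: contra xw => /andP[? /eqP->].
have wu : uniq (nseq (z \in val w) z ++ v).
  have zv : z \notin v by rewrite mem_filter negb_and zr orbT.
  have uv : uniq v by exact: filter_uniq.
  by case: (z \in val w); rewrite /= ?zv ?uv.
have := perm_size (uniq_perm (fset_uniq (val w)) wu wE).
rewrite size_cat size_nseq (eqP (valP w)) => kE.
have vr : subseq v r by exact: filter_subseq.
transitivity (f (a :: rcons v z) w); first by rewrite /= last_rcons.
apply: lP.
- by rewrite eqxx -!cats1 cat_subseq.
- by rewrite /= size_rcons; congr _.+2; rewrite [X in (X - _)%N]kE addKn.
- by exists a, v, z.
Qed.

End Generic.

(** * The kernel and the lifts of a full subgroup *)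

Lemma F2_Z4N (x : 'F_2) : (- F2_Z4 x = F2_Z4 x)%R.
Proof. by apply/eqP; rewrite eq_sym -addr_eq0 F2_Z4_double. Qed.

Lemma F2_natr_odd n : (n%:R = (odd n)%:R :> 'F_2)%R.
Proof.
by rewrite -[in LHS](odd_double_half n) natrD -addnn natrD F2_addxx addr0.
Qed.

Section Calculus.
Context {d : Order.disp_t}.
Variable Omega : orderType d.
Hypothesis Omega_infinite : infinite_set [set: Omega].
Variable k : nat.
Hypothesis k_gt0 : (0 < k)%N.
Variable H : set (sym (C Omega k)).
Hypothesis H_full : full H.
Implicit Types (p : coords Omega k) (w : ksub Omega k).
Implicit Types (S T : {fset Omega}) (g h : sym Omega) (s r : seq Omega).
Implicit Types (a b z : Omega).
Implicit Types (theta eta : ksub Omega k -> 'Z_4) (phi psi : ksub Omega k -> 'F_2).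

Local Open Scope ring_scope.

(** The trace on S of the kernel of H -> Sym(Omega), as a space of
    functions on k-subsets. *)
Definition kernel_on S phi := lifts H S 1%g (fun w => F2_Z4 (phi w)).

Lemma lifts_ext S S' g g' theta theta' : (S' `<=` S)%fset ->
  {in S', g =1 g'} -> (forall w, (val w `<=` S')%fset -> theta w = theta' w) ->
  lifts H S g theta -> lifts H S' g' theta'.
Proof.
move=> SS' gg' tt' [p [Hp pg pt]]; exists p; split=> //.
  by move=> x xS'; rewrite pg ?gg'//; exact: (fsubsetP SS').
by move=> w wS'; rewrite pt ?tt'//; exact: fsubset_trans SS'.
Qed.

Lemma lifts_ext1 S g theta theta' :
  (forall w, (val w `<=` S)%fset -> theta w = theta' w) ->
  lifts H S g theta -> lifts H S g theta'.
Proof. by apply: lifts_ext. Qed.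

Lemma lifts_exists S g : exists theta, lifts H S g theta.
Proof.
have [_ _ _ Hf] := H_full; have [f Hfg] := Hf g.
by exists (shift (f, g)), (f, g); split.
Qed.

Lemma lifts_comp S g h theta eta : lifts H S g theta -> lifts H (img g S) h eta ->
  lifts H S (h * g)%g (fun w => theta w + eta (ksub_act g w)).
Proof.
have [_ [_ HM _] _ _] := H_full.
move=> [p [Hp pg pt]] [q [Hq qh qt]].
have [r [rE r2 rs]] := act_prod Omega_infinite k_gt0 q p.
exists r; split; first by rewrite rE; exact: HM.
  by move=> x xS; rewrite r2 !symM pg// qh// mem_img.
move=> w wS; rewrite rs pt// (act_eq wS pg) qt//.
by rewrite val_act imgS.
Qed.

Lemma lifts_inv S g theta : lifts H S g theta ->
  lifts H (img g S) g^-1%g (fun w => - theta (ksub_act g^-1%g w)).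
Proof.
have [_ [_ _ HV] _ _] := H_full.
move=> [p [Hp pg pt]].
have [r [rE r2 rs]] := act_inv Omega_infinite k_gt0 p.
exists r; split; first by rewrite rE; exact: HV.
  move=> x; rewrite in_img => xS.
  by rewrite r2 -[in LHS](symVK g x) -pg// symK.
move=> w wS; have w'S : (val (ksub_act g^-1%g w) `<=` S)%fset.
  by rewrite -[S]img1 -(mulVg g) imgM val_act imgS.
by rewrite -[w in LHS](ksub_actVK g) -(act_eq w'S pg) rs pt.
Qed.

Lemma lifts_diff S g theta eta : lifts H S g theta -> lifts H S g eta ->
  lifts H S 1%g (fun w => theta w - eta w).
Proof.
move=> Lt /lifts_inv Le; have := lifts_comp Lt Le; rewrite mulVg.
by apply: lifts_ext1 => w _; rewrite ksub_actK.
Qed.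

Lemma lifts_addM S g theta phi : lifts H S g theta -> kernel_on S phi ->
  lifts H S g (fun w => theta w + F2_Z4 (phi w)).
Proof.
move=> Lt Mp; have := @lifts_comp S 1%g g _ theta Mp; rewrite img1 mulg1.
by move=> /(_ Lt); apply: lifts_ext1 => w _; rewrite ksub_act1 addrC.
Qed.

Lemma kernel_on_ext S S' phi phi' : (S' `<=` S)%fset ->
  (forall w, (val w `<=` S')%fset -> phi w = phi' w) ->
  kernel_on S phi -> kernel_on S' phi'.
Proof. by move=> SS' pp; apply: lifts_ext => // w /pp->. Qed.

Lemma kernel_on0 S : kernel_on S (fun=> 0).
Proof.
have [_ [H1 _ _] _ _] := H_full.
exists (fun=> 0, 1%g); split=> //; first by rewrite act_kernel1.
by move=> w _; rewrite /shift /= eps_one addr0.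
Qed.

Lemma kernel_on_add S phi psi : kernel_on S phi -> kernel_on S psi ->
  kernel_on S (fun w => phi w + psi w).
Proof.
by move=> Mp Mq; have := lifts_addM Mp Mq; apply: lifts_ext1 => w _; rewrite F2_Z4D.
Qed.

Lemma kernel_on_sum (I : eqType) (s : seq I) S (phi : I -> ksub Omega k -> 'F_2) :
  (forall i, i \in s -> kernel_on S (phi i)) ->
  kernel_on S (fun w => \sum_(i <- s) phi i w).
Proof.
elim: s => [|i s IHs] Mi.
  by apply: kernel_on_ext (kernel_on0 S) => // w _; rewrite big_nil.
have Mi0 : kernel_on S (phi i) by apply: Mi; rewrite mem_head.
have {}IHs := IHs (fun j js => Mi j (mem_behead (s := i :: s) js)).
by apply: kernel_on_ext (kernel_on_add Mi0 IHs) => // w _; rewrite big_cons.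
Qed.

(** The kernel is normal in H and H maps onto Sym(Omega); conjugation by a
    lift of g moves functions on k-subsets of g S to those of S. *)
Lemma kernel_on_transport S T g phi : (img g S `<=` T)%fset -> kernel_on T phi ->
  kernel_on S (fun w => phi (ksub_act g w)).
Proof.
move=> gST MT; have [theta Lg] := lifts_exists S g.
have MS : kernel_on (img g S) phi by exact: kernel_on_ext MT.
have := lifts_comp Lg MS; rewrite mul1g => L1.
by have := lifts_diff L1 Lg; apply: lifts_ext1 => w _; rewrite addrC addKr.
Qed.

Definition kernel_point (c : bool -> 'F_2) :=
  forall S a, kernel_on S (fun w => c (a \in val w)).
Definition kernel_pair (c : bool -> bool -> 'F_2) :=
  forall S a b, a != b -> kernel_on S (fun w => c (a \in val w) (b \in val w)).

Lemma fset_enum_cons (a : Omega) S : exists s,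
  uniq (a :: s) /\ (S `<=` [fset x in a :: s])%fset.
Proof.
exists (enum_fset (S `\ a)%fset); split=> //=.
  by rewrite fset_uniq andbT; rewrite !inE eqxx.
by apply/fsubsetP => x xS; rewrite !inE; case: eqVneq => //= xa; rewrite !inE xa.
Qed.

(** By transport it does not matter where the marked point is, only how many
    other points there are. *)
Lemma kernel_point_generic c :
  (forall n, exists a r, [/\ size r = n, uniq (a :: r) &
    kernel_on [fset x in a :: r]%fset (fun w => c (a \in val w))]) -> kernel_point c.
Proof.
move=> Mc S a; have [s [us Ss]] := fset_enum_cons a S.
have [b [r [rn ur Mr]]] := Mc (size s).
have [g /= [gab gsr]] : exists g, map g (a :: s) = b :: r.
  by apply: sym_extend => //=; rewrite rn.
apply: kernel_on_ext (kernel_on_transport (g := g) (S := S) _ Mr) => //.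
  by move=> w _; rewrite -gab val_act mem_img.
apply/fsubsetP => x; rewrite in_img => /(fsubsetP Ss); rewrite !inE.
rewrite -gab -gsr; case/predU1P => [<-|xs]; first by rewrite symVK eqxx.
by rewrite -[x](symVK g) map_f ?orbT.
Qed.

Lemma kernel_pair_generic c :
  (forall n, exists a b r, [/\ size r = n, uniq [:: a, b & r] &
    kernel_on [fset x in [:: a, b & r]]%fset
      (fun w => c (a \in val w) (b \in val w))]) ->
  kernel_pair c.
Proof.
move=> Mc S a b ab; pose t := enum_fset (S `\ a `\ b)%fset.
have [a' [b' [r [rn ur Mr]]]] := Mc (size t).
have [g /= [ga gb gt]] : exists g, map g [:: a, b & t] = [:: a', b' & r].
  apply: sym_extend => //=; last by rewrite rn.
  by rewrite fset_uniq !inE !eqxx (negbTE ab).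
apply: kernel_on_ext (kernel_on_transport (g := g) (S := S) _ Mr) => //.
  by move=> w _; rewrite -ga -gb val_act !mem_img.
apply/fsubsetP => x; rewrite in_img => xS; rewrite !inE.
rewrite -ga -gb -gt -[x](symVK g) !(inj_eq (@sym_inj _ g)) (mem_map (@sym_inj _ g)).
by case: eqVneq => //= xa; case: eqVneq => //= xb; rewrite !inE xa xb.
Qed.

Lemma kernel_point_add c c' : kernel_point c -> kernel_point c' ->
  kernel_point (fun i => c i + c' i).
Proof. by move=> Nc Nc' S a; exact: kernel_on_add. Qed.

Lemma kernel_pair_add c c' : kernel_pair c -> kernel_pair c' ->
  kernel_pair (fun i j => c i j + c' i j).
Proof. by move=> Nc Nc' S a b ab; apply: kernel_on_add; [exact: Nc|exact: Nc']. Qed.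

Lemma kernel_point_l c : kernel_point c -> kernel_pair (fun i _ => c i).
Proof. by move=> Nc S a b _; exact: Nc. Qed.

Lemma kernel_point_r c : kernel_point c -> kernel_pair (fun _ j => c j).
Proof. by move=> Nc S a b _; exact: Nc. Qed.

(** The only case that is not immediate is that of the indicator of a not in w.
    Its sum over all a in a finite T containing w is the constant |T| - k,
    which is odd for a suitable T. *)
Lemma kernel_point_const c : kernel_point c -> kernel_point (fun=> c false).
Proof.
move=> Nc; case: (F2P (c false)) => [->|c0]; first by move=> S a; exact: kernel_on0.
case: (F2P (c true)) => [cT|c1]; last first.
  move=> S a; apply: kernel_on_ext (Nc S a) => // w _.
  by case: (a \in _); rewrite c0 ?c1.
move=> S a.
have [T [ST Todd]] : exists T, (S `<=` T)%fset /\ odd (#|` T| + k).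
  have [So|So] := boolP (odd (#|` S| + k)); first by exists S.
  have [y yS] : exists y, y \notin S.
    apply/not_existsP => /= H0; apply: Omega_infinite.
    apply: (@sub_finite_set _ _ [set` S]) => // y _ /=.
    by have := H0 y; move/negP/negPn.
  by exists (y |` S)%fset; split; rewrite ?fsubsetU1// cardfsU1 yS add1n addSn.
have := @kernel_on_sum _ (enum_fset T) S _ (fun b _ => Nc S b).
apply: kernel_on_ext => // w wS; rewrite c0.
transitivity (\sum_(b <- T | b \notin val w) (1 : 'F_2)).
  rewrite [RHS]big_mkcond /=; apply: eq_bigr => b _.
  by case: ifPn => [/negbTE->|/negPn->].
have wT : (val w `<=` T)%fset by exact: fsubset_trans ST.
have cw : count (mem (val w)) T = k.
  rewrite -[RHS](eqP (valP w)) -size_filter; apply/perm_size/uniq_perm.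
  - exact: filter_uniq (fset_uniq T).
  - exact: fset_uniq.
  - by move=> x; rewrite mem_filter /= andb_idr// => /(fsubsetP wT).
rewrite big_const_seq iter_addr_0 F2_natr_odd.
have := count_predC (mem (val w)) T; rewrite cw => cT'.
move: Todd; rewrite -cT' addnAC addnn oddD odd_double /= => ->.
by [].
Qed.

(** * Lifts of transpositions in a normalised full subgroup *)

Hypothesis H_inc : lifts_increasing H.
Variable U : set_system Omega.
Hypothesis UF : UltraFilter U.
Variable e : bool.
Hypothesis Ue : U [set x | U [set y | prec e x y]].

Definition swap_lifted (c : bool -> bool -> 'F_2) := forall n,
  exists a b r, [/\ size r = n, sorted (prec e) [:: a, b & r] &
    lifts H [fset x in [:: a, b & r]]%fset (tsym a b)
      (fun w => F2_Z4 (c (a \in val w) (b \in val w)) + eps (tsym a b) w)].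

Lemma swap_lift : exists c, swap_lifted c.
Proof.
have [_ _ _ Hf] := H_full.
have /choice[f fE] (ab : Omega * Omega) := Hf (tsym ab.1 ab.2).
have [c cE] := generic_initial_pair UF Ue
  (fun a b w => f (a, b) (ksub_act (tsym a b) w)).
exists c => n; have [a [b [r [rn ls rc]]]] := cE n.
exists a, b, r; split=> //; exists (f (a, b), tsym a b); split=> //.
by move=> w wr; rewrite /shift /= rc.
Qed.

Lemma rotation_lift : exists c : bool -> 'F_2, forall n,
  exists a r z, [/\ size r = n, sorted (prec e) (a :: rcons r z) &
    lifts H [fset x in rcons r z]%fset (tsym a z)
      (fun w => F2_Z4 (c (z \in val w)) + eps (tsym a z) w)].
Proof.
have [_ _ _ Hf] := H_full.
have /choice[f fE] (ab : Omega * Omega) := Hf (tsym ab.1 ab.2).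
have [c cE] := generic_end_pair UF Ue
  (fun a b w => f (a, b) (ksub_act (tsym a b) w)).
exists c => n; have [a [r [z [rn ls rc]]]] := cE n.
exists a, r, z; split=> //; exists (f (a, z), tsym a z); split=> //.
by move=> w wr; rewrite /shift /= rc.
Qed.

(** The first two functions are restrictions of the lift to sets on which the
    transposition preserves the order, compared with the lift of shift 0 that
    exists there.  The third is its square, see eps_swap_square. *)
Lemma swap_lift_kernel c : swap_lifted c ->
  [/\ kernel_point (fun i => c i false), kernel_point (fun j => c false j) &
   kernel_pair (fun i j => c i j + c j i + (i && j)%:R)].
Proof.
move=> cP; split.
- apply: kernel_point_generic => n.
  have [a [b [r [rn ls L]]]] := cP n; exists a, r.
  have /= := prec_uniq ls; rewrite inE negb_or => /and3P[/andP[ab ar] br ur].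
  split=> //=; first by rewrite ar ur.
  have inc := swap_increasing_l ls.
  have sub : ([fset x in a :: r] `<=` [fset x in [:: a, b & r]])%fset.
    by apply/fsubsetP => x; rewrite !inE => /orP[]->; rewrite ?orbT.
  have L' : lifts H [fset x in a :: r]%fset (tsym a b) _ :=
    lifts_ext sub (fun _ _ => erefl) (fun _ _ => erefl) L.
  have := lifts_diff L' (H_inc inc); apply: lifts_ext1 => w wr.
  rewrite eps_increasing; last exact: increasing_onS wr inc.
  have /negbTE-> : b \notin val w.
    apply: contra br => /(fsubsetP wr); rewrite !inE.
    by rewrite eq_sym (negbTE ab).
  by rewrite addr0 subr0.
- apply: kernel_point_generic => n.
  have [a [b [r [rn ls L]]]] := cP n; exists b, r.
  have /= := prec_uniq ls; rewrite inE negb_or => /and3P[/andP[ab ar] br ur].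
  split=> //=; first by rewrite br ur.
  have inc := swap_increasing_r ls.
  have sub : ([fset x in b :: r] `<=` [fset x in [:: a, b & r]])%fset.
    by apply/fsubsetP => x; rewrite !inE => /orP[]->; rewrite ?orbT.
  have L' : lifts H [fset x in b :: r]%fset (tsym a b) _ :=
    lifts_ext sub (fun _ _ => erefl) (fun _ _ => erefl) L.
  have := lifts_diff L' (H_inc inc); apply: lifts_ext1 => w wr.
  rewrite eps_increasing; last exact: increasing_onS wr inc.
  have /negbTE-> : a \notin val w.
    by apply: contra ar => /(fsubsetP wr); rewrite !inE (negbTE ab).
  by rewrite addr0 subr0.
- apply: kernel_pair_generic => n.
  have [a [b [r [rn ls L]]]] := cP n; exists a, b, r.
  have ur := prec_uniq ls; split=> //.
  set S := [fset x in _]%fset in L *.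
  have aS : a \in S by rewrite !inE eqxx.
  have bS : b \in S by rewrite !inE eqxx orbT.
  have ab : a != b by move: ur; rewrite /= inE negb_or => /andP[/andP[]].
  have := @lifts_comp _ _ (tsym a b) _ _ L; rewrite img_swap// tsymM => /(_ _ L).
  apply: lifts_ext1 => w wS; rewrite in_swap_l in_swap_r.
  have -> : forall A B C D : 'Z_4, A + B + (C + D) = A + C + (D + B).
    by move=> *; ring.
  rewrite eps_swap_square//; last exact: swap_adjacent ls wS.
  by rewrite !F2_Z4D.
Qed.

(** The asymmetric part c(1,0) + c(0,1) of the square is removed with the help
    of the functions of one point in swap_lift_kernel. *)
Lemma pair_indicator_mem : kernel_pair (fun i j => (i && j)%:R).
Proof.
have [c /swap_lift_kernel[N1 N1' N2]] := swap_lift.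
have A1 := kernel_point_add N1 N1'.
have := kernel_pair_add N2
  (kernel_pair_add (kernel_point_l A1) (kernel_point_r A1)).
suff -> : (fun i j : bool => (i && j)%:R : 'F_2) =
  (fun i j => c i j + c j i + (i && j)%:R +
     (c i false + c false i + (c j false + c false j))) by [].
apply/funext => -[]; apply/funext => -[] /=;
  case: (F2P (c true true)) => E1; case: (F2P (c true false)) => E2;
  case: (F2P (c false true)) => E3; case: (F2P (c false false)) => E4;
  rewrite ?E1 ?E2 ?E3 ?E4; exact/val_inj.
Qed.

(** The image of alpha is spanned, locally, by the indicators of the k-sets
    containing a given pair. *)
Lemma alpha2_mem S (f : ksub Omega 2 -> 'F_2) : kernel_on S (alpha2 f).
Proof.
have Mf y : kernel_on S (fun w => if (val y `<=` val w)%fset then f y else 0).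
  have M0 := kernel_on0 S.
  case: (F2P (f y)) => fy.
    by apply: kernel_on_ext M0 => // w _; rewrite fy; case: ifP.
  have [a [b [ab yE]]] := ksub2P y.
  have := pair_indicator_mem S.
  move=> /(_ a b); rewrite lt_eqF// => /(_ isT); apply: kernel_on_ext => // w _.
  by rewrite yE fsubUset !fsub1set fy; case: (_ && _).
have := kernel_on_sum (s := @ksubs _ Omega 2 S) (fun y _ => Mf y).
apply: kernel_on_ext => // w wS; rewrite -big_mkcond /= /alpha2 -big_filter.
apply: perm_big; apply: uniq_perm.
- by apply: filter_uniq; apply: pmap_sub_uniq; exact: fset_uniq.
- exact: fset_uniq.
- move=> y; rewrite mem_filter in_ksubs in_pairs_of andb_idr// => yw.
  exact: fsubset_trans yw wS.
Qed.

(** Lifts measured against (0,g).  Since the kernel contains the image of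
    alpha, the functions phi compose without a correction term. *)
Definition twisted S g phi := lifts H S g (fun w => F2_Z4 (phi w) + eps g w).

Lemma twisted_ext S S' g g' phi phi' : (S' `<=` S)%fset -> {in S', g =1 g'} ->
  (forall w, (val w `<=` S')%fset -> phi w = phi' w) ->
  twisted S g phi -> twisted S' g' phi'.
Proof.
move=> SS' gg' pp'; apply: lifts_ext => // w wS'; rewrite pp'//.
by congr (_ + _); apply: eps_eq => x /(fsubsetP wS'); exact: gg'.
Qed.

Lemma twisted_comp S g h phi psi :
  twisted S g phi -> twisted (img g S) h psi ->
  twisted S (h * g)%g (fun w => phi w + psi (ksub_act g w)).
Proof.
move=> Tg Th; have [c cE] := eps_cocycle_alpha h g.
have := lifts_addM (lifts_comp Tg Th) (alpha2_mem S c).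
apply: lifts_ext1 => w _; rewrite F2_Z4D.
transitivity (F2_Z4 (phi w) + F2_Z4 (psi (ksub_act g w)) + F2_Z4 (alpha2 c w)
  + (eps h (ksub_act g w) + eps g w)); first by ring.
rewrite cE; transitivity (F2_Z4 (phi w) + F2_Z4 (psi (ksub_act g w)) +
  eps (h * g)%g w + (F2_Z4 (alpha2 c w) + F2_Z4 (alpha2 c w))); first by ring.
by rewrite F2_Z4_double addr0.
Qed.

Lemma twisted_inv S g phi : twisted S g phi ->
  twisted (img g S) g^-1%g (fun w => phi (ksub_act g^-1%g w)).
Proof.
move=> Tg; have [c cE] := eps_cocycle_alpha g g^-1%g.
have := lifts_addM (lifts_inv Tg) (alpha2_mem (img g S) c).
apply: lifts_ext1 => w _; have := cE k w; rewrite mulgV eps_one add0r => <-.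
by rewrite opprD F2_Z4N; ring.
Qed.

(** Locally, (0,g) belongs to H. *)
Definition standard S g := twisted S g (fun=> 0).

Lemma standard_ext S S' g g' : (S' `<=` S)%fset -> {in S', g =1 g'} ->
  standard S g -> standard S' g'.
Proof. by move=> SS' gg'; apply: twisted_ext. Qed.

Lemma standard_comp S g h : standard S g -> standard (img g S) h ->
  standard S (h * g)%g.
Proof.
move=> Sg Sh; have := twisted_comp Sg Sh.
by apply: twisted_ext => // w _; rewrite addr0.
Qed.

Lemma standard_inv S g : standard S g -> standard (img g S) g^-1%g.
Proof. exact: twisted_inv. Qed.

Lemma standard_increasing S g : increasing_on S g -> standard S g.
Proof.
move=> gS; apply: lifts_ext1 (H_inc gS) => w wS.
by rewrite F2_Z4_0 add0r eps_increasing//; exact: increasing_onS wS gS.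
Qed.

(** The function c of swap_lift is a combination of functions already known to
    be in the kernel: constants, functions of one point, and the indicator of
    a pair. *)
Lemma standard_initial_swap n : exists a b r,
  [/\ size r = n, sorted (prec e) [:: a, b & r] &
    standard [fset x in [:: a, b & r]]%fset (tsym a b)].
Proof.
have [c cP] := swap_lift.
have [N1 N1' _] := swap_lift_kernel cP.
have N11 := pair_indicator_mem.
have [a [b [r [rn ls L]]]] := cP n; exists a, b, r; split=> //.
have ab : a != b.
  by have := prec_uniq ls; rewrite /= inE negb_or => /andP[/andP[]].
have N00 := kernel_point_const N1.
have N10 := kernel_point_add N1 N00.
have N01 := kernel_point_add N1' (kernel_point_const N1').
pose m := c true true + c true false + c false true + c false false.
have N11m : kernel_pair (fun i j => m * (i && j)%:R).
  move=> S x y xy; case: (F2P m) => ->.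
    by apply: kernel_on_ext (kernel_on0 S) => // w _; rewrite mul0r.
  by apply: kernel_on_ext (N11 S x y xy) => // w _; rewrite mul1r.
(* The expansion of c as a polynomial in the indicators of a and b over F_2. *)
have Mc : kernel_pair c.
  have Nsum := kernel_pair_add (kernel_pair_add (kernel_point_l N00) N11m)
    (kernel_pair_add (kernel_point_l N10) (kernel_point_r N01)).
  suff cE : c = (fun i j => c false false + m * (i && j)%:R +
      (c i false + c false false + (c false j + c false false))) by rewrite cE.
  rewrite /m; apply/funext => -[]; apply/funext => -[] /=;
    case: (F2P (c true true)) => E1; case: (F2P (c true false)) => E2;
    case: (F2P (c false true)) => E3; case: (F2P (c false false)) => E4;
    rewrite ?E1 ?E2 ?E3 ?E4; exact/val_inj.
have := lifts_addM L (Mc _ _ _ ab); apply: lifts_ext1 => w _.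
by rewrite addrAC F2_Z4_double; congr (_ + _); rewrite F2_Z4_0.
Qed.

(** The map exchanging a and z sends r followed by z to a followed by r; up to
    order it rotates.  Restricted to r it is the identity, so the constant term
    of its lift is in the kernel. *)
Lemma twisted_rotation : exists t : 'F_2, forall n, exists a r z,
  [/\ size r = n, sorted (prec e) (a :: rcons r z) &
    twisted [fset x in rcons r z]%fset (tsym a z)
      (fun w => t * (z \in val w)%:R)].
Proof.
have [c cP] := rotation_lift.
exists (c true + c false) => n.
have [a [r [z [rn ls L]]]] := cP n; exists a, r, z; split=> //.
have N0 : kernel_point (fun=> c false).
  apply: kernel_point_generic => m.
  have [a' [r0 [z' [+ ls' L']]]] := cP m.+1.
  case: r0 ls' L' => [//|x r'] ls' L' [rm].
  have /= := @prec_uniq _ _ e (a' :: rcons (x :: r') z') ls'.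
  rewrite !inE !mem_rcons rcons_uniq !inE !negb_or.
  move=> /and3P[/and3P[ax az ar] /andP[xz xr] /andP[zr ur]].
  exists x, r'; split=> //; first by rewrite /= xr ur.
  have sub : ([fset y in x :: r'] `<=` [fset y in rcons (x :: r') z'])%fset.
    by apply/fsubsetP => y; rewrite !inE mem_rcons !inE => /orP[]->; rewrite ?orbT.
  have fixr : {in [fset y in x :: r']%fset, tsym a' z' =1 (1%g : sym Omega)}.
    move=> y; rewrite !inE => yxr; rewrite sym1 tsymD//.
      by apply: contraTneq yxr => ->; rewrite negb_or ax ar.
    by apply: contraTneq yxr => ->; rewrite negb_or eq_sym xz zr.
  have : lifts H [fset y in x :: r']%fset 1%g _ :=
    lifts_ext sub fixr (fun _ _ => erefl) L'.
  apply: lifts_ext1 => w wr.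
  rewrite (eps_eq (h := 1%g)); last by move=> y /(fsubsetP wr); exact: fixr.
  have /negbTE-> : z' \notin val w.
    apply/negP => /(fsubsetP wr); rewrite !inE eq_sym (negbTE xz) /=.
    by rewrite (negbTE zr).
  by rewrite eps_one addr0.
have := lifts_addM L (N0 _ a); apply: lifts_ext1 => w _.
rewrite addrAC -F2_Z4D; congr (F2_Z4 _ + _).
by case: (z \in val w); rewrite ?mulr1 ?mulr0 ?F2_addxx.
Qed.

(** Transpositions by rank: by standard_swap_transport, whether (0,g) is locally
    in H depends only on the ranks of the two points moved by g. *)
Definition standard_swap n i j := forall x0 s, sorted (prec e) s -> size s = n ->
  standard [fset x in s]%fset (tsym (nth x0 s i) (nth x0 s j)).

Lemma standard_swap_transport n i j x0 s : (i < n)%N -> (j < n)%N ->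
  sorted (prec e) s -> size s = n ->
  standard [fset x in s]%fset (tsym (nth x0 s i) (nth x0 s j)) ->
  standard_swap n i j.
Proof.
move=> ni nj ss sn st y0 s' ss' sn'.
have [q qs] : exists q : sym Omega, map q s' = s.
  by apply: sym_extend (prec_uniq ss') (prec_uniq ss) _; rewrite sn.
have sE' : s' =i [fset x in s']%fset by move=> x; rewrite !inE.
have qinc : increasing_on [fset x in s']%fset q.
  by apply/(increasing_onP _ sE' ss'); rewrite qs.
have qS : img q [fset x in s']%fset = [fset x in s]%fset by rewrite img_fset qs.
have Sq := standard_increasing qinc.
have Sqv := standard_inv Sq; rewrite qS in Sqv.
have qnth m : (m < n)%N -> nth x0 s m = q (nth y0 s' m).
  by move=> nm; rewrite -qs (nth_map y0) ?sn'.
have inS m : (m < n)%N -> nth x0 s m \in [fset x in s]%fset.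
  by move=> nm; rewrite !inE mem_nth ?sn.
have := @standard_comp _ q (tsym (nth x0 s i) (nth x0 s j)) Sq.
rewrite qS => /(_ st) S1.
have := @standard_comp _ _ q^-1%g S1.
rewrite imgM qS img_swap ?inS// => /(_ Sqv).
by rewrite [in X in _ -> X](tsymJ q) -!mulgA -(qnth i ni) -(qnth j nj).
Qed.

Lemma standard_swap_initial n : standard_swap n.+2 0 1.
Proof.
have [a [b [r [rn ls st]]]] := standard_initial_swap n.
by apply: (standard_swap_transport (x0 := a) (s := [:: a, b & r])) => //=; rewrite rn.
Qed.

(** A transposition tau of two points of r is conjugated by the rotation to
    itself.  The error term t * (z in w) of the rotation is invariant under
    tau, so it occurs twice in the conjugate and cancels. *)
Lemma standard_swap_rotate n i j : (i < n)%N -> (j < n)%N ->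
  standard_swap n.+1 i j -> standard_swap n.+1 i.+1 j.+1.
Proof.
move=> ni nj st; have [t tP] := twisted_rotation.
have [a [r [z [rn ls T]]]] := tP n.
have := @prec_uniq _ _ e (a :: rcons r z) ls.
rewrite cons_uniq rcons_uniq mem_rcons inE negb_or => /and3P[/andP[az ar] zr ur].
have ls1 : sorted (prec e) (rcons r z) by exact: path_sorted ls.
have ls2 : sorted (prec e) (a :: r).
  move: ls; rewrite -rcons_cons.
  by move=> /(subseq_sorted (@prec_trans _ Omega e) (subseq_rcons _ _)).
pose x := nth a r i; pose y := nth a r j.
have xr : x \in r by rewrite mem_nth ?rn.
have yr : y \in r by rewrite mem_nth ?rn.
have fixr u : u \in r -> (u != a) * (u != z).
  by move=> ur'; split; [apply: contraNneq ar|apply: contraNneq zr] => <-.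
have stau : standard [fset u in rcons r z]%fset (tsym x y).
  have := st a (rcons r z) ls1; rewrite size_rcons rn => /(_ erefl).
  by rewrite !nth_rcons rn ni nj.
set S := [fset u in rcons r z]%fset in T stau.
have imgS : img (tsym a z) S = [fset u in a :: r]%fset.
  rewrite img_fset map_rcons tsymR; apply/fsetP => u; rewrite !inE mem_rcons inE.
  congr (_ || _); congr (_ \in _).
  rewrite -[RHS]map_id; apply/eq_in_map => v vr; rewrite tsymD ?fixr//.
apply: (standard_swap_transport (x0 := a) (s := a :: r)) => //=.
  by rewrite rn.
rewrite -/x -/y -imgS.
have xS : x \in S by rewrite !inE mem_rcons inE xr orbT.
have yS : y \in S by rewrite !inE mem_rcons inE yr orbT.
have Tv := twisted_inv T.
have back : img (tsym a z)^-1%g (img (tsym a z) S) = S by rewrite -imgM mulVg img1.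
have := twisted_comp (h := tsym x y) (psi := fun=> 0) Tv; rewrite back => /(_ stau) T2.
have := twisted_comp (h := tsym a z) T2.
rewrite imgM back img_swap// => /(_ _ T).
have -> : (tsym a z * (tsym x y * (tsym a z)^-1))%g = tsym x y.
  rewrite [RHS](tsymJ (tsym a z)) tsymV.
  by rewrite (@tsymD _ a z x) ?(@tsymD _ a z y) ?fixr// mulgA.
apply: twisted_ext => // w _; rewrite addr0.
rewrite ksub_actM; set v := ksub_act _ w.
have -> : (z \in val (ksub_act (tsym x y) v)) = (z \in val v).
  rewrite -{1}[z](@tsymD _ x y) ?val_act ?mem_img//.
    by rewrite eq_sym fixr.
  by rewrite eq_sym fixr.
exact: F2_addxx.
Qed.

(** Rotation reduces to i = 0, and then (0 j+1) is the conjugate of (1 j+1)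
    by (0 1). *)
Lemma standard_swap_all n i j : (i < j)%N -> (j < n)%N -> standard_swap n i j.
Proof.
elim: j i => [//|j IHj] [_|i]; last first.
  case: n IHj => [//|n] IHj; rewrite !ltnS => ij jn.
  by apply: standard_swap_rotate => //; [exact: ltn_trans jn|exact: IHj (ltnW _)].
case: n IHj => [//|[//|n]] IHj jn; case: j IHj jn => [|j] IHj jn.
  exact: standard_swap_initial.
move=> x0 s ss sn.
have S01 := standard_swap_initial x0 ss sn.
have S0j := IHj 0%N (ltn0Sn _) (ltnW jn).
have S1j := @standard_swap_rotate n.+1 0 j.+1 (ltn0Sn _) jn S0j x0 s ss sn.
set S := [fset x in s]%fset in S01 S1j *; set a := nth x0 s 0 in S01 *.
set b := nth x0 s 1 in S01 S1j *; set c := nth x0 s j.+2 in S1j *.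
have inS m : (m < n.+2)%N -> nth x0 s m \in S by move=> nm; rewrite !inE mem_nth ?sn.
have us := prec_uniq ss.
have ab : a != b by rewrite nth_uniq ?sn.
have ac : a != c by rewrite nth_uniq ?sn.
have bc : b != c by rewrite nth_uniq ?sn.
have imgS : img (tsym a b) S = S by rewrite img_swap ?inS.
have S01v := standard_inv S01; rewrite imgS in S01v.
have := @standard_comp S (tsym a b) (tsym b c) S01; rewrite imgS => /(_ S1j) S2.
have := @standard_comp S _ (tsym a b)^-1%g S2; rewrite imgM imgS img_swap ?inS//.
move=> /(_ S01v).
by rewrite [tsym a c](tsymJ (tsym a b)) tsymL (@tsymD _ a b c) ?mulgA// eq_sym.
Qed.

Lemma standard_tsym S a b : standard S (tsym a b).
Proof.
have [<-|ab] := eqVneq a b.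
  apply: standard_increasing => x y _ _.
  by rewrite !tsymE /swap; case: eqVneq => [->|_]; case: eqVneq => [->|_].
have [s [ss sE sn]] := prec_enum e (a |` (b |` S))%fset.
have aS : a \in s by rewrite sE !inE eqxx.
have bS : b \in s by rewrite sE !inE eqxx orbT.
have SS : (S `<=` [fset x in s])%fset.
  by apply/fsubsetP => x xS; rewrite inE /= sE !inE xS !orbT.
apply: (standard_ext SS (g := tsym a b)) => //.
have [ij|ji|ij] := ltngtP (index a s) (index b s).
- have := standard_swap_all (n := size s) ij; rewrite index_mem => /(_ bS a s ss erefl).
  by rewrite !nth_index.
- have := standard_swap_all (n := size s) ji; rewrite index_mem => /(_ aS a s ss erefl).
  by rewrite !nth_index// tsymC.
- by move: ab; rewrite -(nth_index a aS) ij nth_index// eqxx.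
Qed.

(** Composing g with the transposition of x and g x fixes x as well as all the
    points of S that g fixes. *)
Lemma standard_all S g : standard S g.
Proof.
pose D g := [fset x in S | g x != x]%fset.
have [n] := ubnP #|` D g|; elim: n g => [//|n IHn] g; rewrite ltnS => Dn.
have [D0|[x]] := fset_0Vmem (D g).
  apply: (standard_ext (S := S) (g := 1%g)) => //; last exact: standard_increasing.
  move=> x xS; apply/esym/eqP/negPn; have : x \notin D g by rewrite D0.
  by rewrite !inE xS.
rewrite !inE => /andP[xS gx].
have gE : g = (tsym x (g x) * (tsym x (g x) * g))%g by rewrite mulgA tsymM mul1g.
rewrite [g in standard S g]gE; apply: standard_comp (standard_tsym _ _ _).
apply: IHn; apply: leq_trans Dn.
have xD : x \in D g by rewrite !inE xS.
rewrite (cardfsD1 x (D g)) xD add1n ltnS; apply: fsubset_leq_card.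
apply/fsubsetP => y; rewrite !inE symM => /andP[yS gy]; rewrite yS.
have [yx|yx] := eqVneq y x; first by rewrite yx tsymR eqxx in gy.
apply: contraNneq gy => gy; rewrite gy tsymD//.
by apply: contraNneq yx => yE; apply/eqP/(@sym_inj _ g); rewrite -yE.
Qed.

(** An element of the image is locally the product of (0,g) and an element of
    the image of alpha. *)
Lemma im_gamma2_sub_normalised : im_gamma2 Omega k `<=` H.
Proof.
have [_ _ Hc _] := (full_localP H).1 H_full.
move=> _ [[f g] _ <-]; apply: Hc => F Ff.
have [X XE] : exists X : {fset ksub Omega k}, [set z.2 | z in F] = [set` X].
  exact/finite_fsetP/finite_image.
pose S := (\bigcup_(w <- X) val w)%fset.
have FS (u : C Omega k) : F u -> (val u.2 `<=` S)%fset.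
  move=> Fu; have : [set z.2 | z in F] u.2 by exists u.
  by rewrite XE /= => uX; apply: bigfcup_sup.
have := lifts_addM (standard_all S g) (kernel_on_transport
  (fsubset_refl _) (alpha2_mem (img g S) f)).
move=> [q [Hq qg qs]]; exists (act q) => // -[a w] /FS wS.
rewrite !actE qs// (act_eq wS qg); congr (_ + _, _).
by rewrite /shift /= F2_Z4_0 add0r addrC.
Qed.

End Calculus.

(** * Conjugates and minimality *)

Section MinimallyFull.
Context {d : Order.disp_t}.
Variable Omega : orderType d.
Hypothesis Omega_infinite : infinite_set [set: Omega].
Variable k : nat.
Hypothesis k_gt0 : (0 < k)%N.
Implicit Types H K : set (sym (C Omega k)).

Lemma conjugateM (G : groupType) (b c : G) (H : set G) :
  conjugate b (conjugate c H) = conjugate (b * c)%g H.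
Proof.
apply/seteqP; split=> [_ [_ [h Hh <-] <-]|_ [h Hh <-]].
  by exists h; rewrite ?invgM ?mulgA.
by exists (c * h * c^-1)%g; [exists h|rewrite invgM !mulgA].
Qed.

Lemma conjugate1 (G : groupType) (H : set G) : conjugate 1%g H = H.
Proof.
apply/seteqP; split=> [_ [h Hh <-]|h Hh]; first by rewrite invg1 mulg1 mul1g.
by exists h; rewrite // invg1 mulg1 mul1g.
Qed.

Lemma conjugate_sub (G : groupType) (c : G) (H K : set G) : H `<=` K ->
  conjugate c H `<=` conjugate c K.
Proof. by move=> HK _ [h Hh <-]; exists h => //; exact: HK. Qed.

Lemma conj_commutator (G : groupType) (n x : G) :
  (n * (n * x * n^-1 * x^-1) = n * x * n^-1 * x^-1 * n)%g ->
  (n * ((n * x * n^-1 * x^-1)^-1 * x) * n^-1)%g = x.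
Proof.
set m := (n * x * n^-1 * x^-1)%g => nm.
apply: (mulgI m); rewrite !mulgA -nm mulgK.
by rewrite /m mulgVK.
Qed.

Lemma full_contains_conjugate H : full H ->
  exists2 c, Gamma Omega k c & conjugate c (im_gamma2 Omega k) `<=` H.
Proof.
move=> Hfull.
have [c Gc cH] := full_normalise Omega_infinite k_gt0 Hfull.
have [U UF U_free] := free_ultrafilter Omega_infinite.
have [e Ue] := ultra_direction UF U_free.
have := im_gamma2_sub_normalised Omega_infinite k_gt0
  (conjugate_full Omega_infinite k_gt0 Gc Hfull) cH UF Ue.
move=> /(@conjugate_sub _ c^-1%g); rewrite conjugateM mulVg conjugate1 => sub.
by exists c^-1%g => //; exact: GammaV.
Qed.

(** Modulo the image I, which is full, c is an element n of the kernel.  For x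
    in I the commutator m of n and x lies in I, by assumption, and in the
    kernel, which is abelian.  So x is the conjugate by n of m^-1 x. *)
Lemma conjugate_sub_eq c : Gamma Omega k c ->
  conjugate c (im_gamma2 Omega k) `<=` im_gamma2 Omega k ->
  conjugate c (im_gamma2 Omega k) = im_gamma2 Omega k.
Proof.
move=> [p _ pE]; have [IG [I1 IM IV] _ If] := im_gamma2_full Omega_infinite k_gt0.
set I := im_gamma2 Omega k in IG I1 IM IV If *.
have [f If2] := If p.2.
have [qv [qvE qv2 _]] := act_inv Omega_infinite k_gt0 (f, p.2).
have [n [nE n2 _]] := act_prod Omega_infinite k_gt0 p qv.
have {}n2 : n.2 = 1%g by rewrite n2 qv2 /= mulgV.
have cE : c = (act n * act (f, p.2))%g by rewrite nE qvE -pE mulgVK.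
have conjI b : I b -> conjugate b I = I.
  move=> Ib; apply/seteqP; split=> [_ [h Ih <-]|h Ih].
    exact: IM (IM _ _ Ib Ih) (IV _ Ib).
  exists (b^-1 * h * b)%g; first exact: IM (IM _ _ (IV _ Ib) Ih) Ib.
  by rewrite !mulgA mulgV mul1g mulgK.
rewrite cE -conjugateM conjI// => sub; apply/seteqP; split=> // x Ix.
have Iy : I (act n * x * (act n)^-1)%g by apply: sub; exists x.
have Im : I (act n * x * (act n)^-1 * x^-1)%g by exact: IM Iy (IV _ Ix).
exists ((act n * x * (act n)^-1 * x^-1)^-1 * x)%g; first exact: IM (IV _ Im) Ix.
have [q _ qE] := IG _ Ix.
have [qi [qiE qi2 _]] := act_inv Omega_infinite k_gt0 q.
have [ni [niE ni2 _]] := act_inv Omega_infinite k_gt0 n.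
have [m1 [m1E m12 _]] := act_prod Omega_infinite k_gt0 n q.
have [m2 [m2E m22 _]] := act_prod Omega_infinite k_gt0 m1 ni.
have [m [mE mn _]] := act_prod Omega_infinite k_gt0 m2 qi.
have {}mn : m.2 = 1%g by rewrite mn m22 m12 ni2 qi2 n2 mul1g invg1 mulg1 mulgV.
have mx : (act n * x * (act n)^-1 * x^-1)%g = act m.
  by rewrite mE m2E m1E niE qiE qE.
rewrite mx; have comm : (act n * act m)%g = (act m * act n)%g.
  apply: sym_ext => -[a w]; rewrite !symM !actE mn n2 !ksub_act1.
  by rewrite addrAC.
by rewrite -mx in comm *; exact: conj_commutator comm.
Qed.

End MinimallyFull.

Theorem theorem4p8 (d : Order.disp_t) (Omega : orderType d)
    (Omega_infinite : infinite_set [set: Omega]) (k : nat) (hk : (3 <= k)%N) :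
  [set conjugate c (im_gamma2 Omega k) | c in Gamma Omega k] =
  [set H | @minimally_full _ Omega k H].
Proof.
have k_gt0 : (0 < k)%N by exact: leq_trans hk.
have Ifull := im_gamma2_full Omega_infinite k_gt0.
apply/seteqP; split=> [_ [c Gc <-]|H [Hfull Hmin]].
  split=> [|K Kfull KI]; first exact: conjugate_full.
  have [b Gb bK] := full_contains_conjugate Omega_infinite k_gt0 Kfull.
  have bI : conjugate (c^-1 * b)%g (im_gamma2 Omega k) `<=` im_gamma2 Omega k.
    have := @conjugate_sub _ c^-1%g _ _ (subset_trans bK KI).
    by rewrite !conjugateM mulVg conjugate1.
  have Gcb : Gamma Omega k (c^-1 * b)%g by apply: GammaM => //; exact: GammaV.
  apply/seteqP; split=> //; apply: subset_trans bK.
  rewrite -[in X in X `<=` _](conjugate_sub_eq Omega_infinite k_gt0 Gcb bI).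
  by rewrite conjugateM mulgA mulgV mul1g.
have [c Gc cH] := full_contains_conjugate Omega_infinite k_gt0 Hfull.
by exists c => //; apply: Hmin => //; exact: conjugate_full.
Qed.
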